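(* Let $G$ be a Lie group, $\pi:P\to M$ a principal $G$-bundle and $\bar A$ a connection form on it. Let $$\mathrm{ev}_0^*P=\{(\gamma,p)\in\mathcal{P}M\times P:\gamma_0=\pi(p)\},$$ where $\gamma_0$ is the initial point of $\gamma$, with right $G$-action $(\gamma,p)g=(\gamma,pg)$ and projection $\pi_0:\mathrm{ev}_0^*P\to\mathcal{P}M$, $(\gamma,p)\mapsto\gamma$. Then the mapping $$\mu:\mathrm{ev}_0^*P\to\mathcal{P}_{\bar A}P,\qquad (\gamma,p)\mapsto\bar\gamma^{\bar A}_p,$$ where $\bar\gamma^{\bar A}_p$ is the $\bar A$-horizontal lift of $\gamma$ initiating at $p$, is a $G$-equivariant bijection, and it satisfies $\pi_{\bar A}\circ\mu=\pi_0$.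
   Context: $\mathcal{P}M$ is the set of $C^\infty$ paths $\gamma:[t_0,t_1]\to M$ ($t_0<t_1$ arbitrary reals) that are constant near $t_0$ and near $t_1$, where two paths differing by a translation of the time parameter ($\gamma$ and $t\mapsto\gamma(t+a)$ on $[t_0-a,t_1-a]$) are identified. $\mathcal{P}_{\bar A}P$ is the set of $C^\infty$ paths $\bar\gamma:[t_0,t_1]\to P$, constant near $t_0$ and $t_1$, that are $\bar A$-horizontal, i.e. $\bar A(\bar\gamma'(t))=0$ for all $t$, with the same identification under time translation. The projection $\pi_{\bar A}:\mathcal{P}_{\bar A}P\to\mathcal{P}M$ is $\bar\gamma\mapsto\pi\circ\bar\gamma$, and $G$ acts on $\mathcal{P}_{\bar A}P$ on the right by $(\bar\gamma g)(t)=\bar\gamma(t)g$. The $\bar A$-horizontal lift of $\gamma$ initiating at $p$ is the $\bar A$-horizontal path on $P$ with initial point $p$ that projects to $\gamma$. No topology or smooth structure on path spaces is used. *)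

(* Defs.v *)
From HB Require Import structures.
From mathcomp Require Import all_boot all_order all_algebra generic_quotient.
From mathcomp Require Import all_classical all_reals all_analysis.

Set Implicit Arguments.
Unset Strict Implicit.
Unset Printing Implicit Defensive.

Import Order.TTheory GRing.Theory Num.Theory.
Import numFieldNormedType.Exports.

Local Open Scope classical_set_scope.
Local Open Scope ring_scope.
Local Open Scope quotient_scope.

Section smoothness.
Context {R : realType}.

Fixpoint Ck (k : nat) (E F : normedModType R) (U : set E) (f : E -> F) : Prop :=
  if k is j.+1 then
    (forall x, U x -> differentiable f x) /\
    (forall v, Ck j U (fun x => 'D_v f x))
  else forall x, U x -> {for x, continuous f}.

(* Meant for U open and E finite-dimensional. *)
Definition Cinfty (E F : normedModType R) (U : set E) (f : E -> F) : Prop :=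
  forall k, Ck k U f.

End smoothness.

(* A homeomorphism between an open subset of T and an open subset of R^n; the
   values of [coord] outside [dom] and of [param] outside [cod] are junk. *)
Record chart (R : realType) (n : nat) (T : topologicalType) := Chart {
  dom : set T;
  cod : set 'rV[R]_n;
  coord :> T -> 'rV[R]_n;
  param : 'rV[R]_n -> T;
  open_dom : open dom;
  open_cod : open cod;
  coord_cod : forall p, dom p -> cod (coord p);
  param_dom : forall x, cod x -> dom (param x);
  coordK : forall p, dom p -> param (coord p) = p;
  paramK : forall x, cod x -> coord (param x) = x;
  coord_continuous : forall p, dom p -> {for p, continuous coord};
  param_continuous : forall x, cod x -> {for x, continuous param}
}.

(* The atlas need not be maximal.  As each tangent space is read in one chart,
   the structure singles out a chart [chart_at p] around every point p. *)
HB.mixin Record isManifold (R : realType) (n : nat) M of Topological M := {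
  atlas : set (chart R n M);
  chart_at : M -> chart R n M;
  chart_at_atlas : forall p, atlas (chart_at p);
  chart_at_dom : forall p, dom (chart_at p) p;
  transition_smooth : forall c d, atlas c -> atlas d ->
    Cinfty (cod c `&` param c @^-1` dom d) (d \o param c);
  manifold_hausdorff : hausdorff_space M;
  manifold_second_countable : @second_countable M
}.

#[short(type="manifoldType")]
HB.structure Definition Manifold (R : realType) (n : nat) :=
  {M of Topological M & isManifold R n M}.

Section smooth_maps.
Context {R : realType}.

Definition smooth_into (E : normedModType R) (n : nat) (N : manifoldType R n)
    (W : set E) (f : E -> N) : Prop :=
  (forall x, W x -> {for x, continuous f}) /\
  (forall c : chart R n N, atlas c -> Cinfty (W `&` f @^-1` dom c) (c \o f)).

Definition smooth_on (m n : nat) (M : manifoldType R m) (N : manifoldType R n)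
    (U : set M) (F : M -> N) : Prop :=
  forall c : chart R m M, atlas c ->
    smooth_into (cod c `&` param c @^-1` U) (F \o param c).

(* Smoothness on an open subset of the product manifold L x M, in the product
   charts. *)
Definition smooth_on2 (l m n : nat) (L : manifoldType R l)
    (M : manifoldType R m) (N : manifoldType R n)
    (U : set (L * M)) (F : L -> M -> N) : Prop :=
  forall (c : chart R l L) (d : chart R m M), atlas c -> atlas d ->
    smooth_into
      [set x : 'rV[R]_l * 'rV[R]_m |
        [/\ cod c x.1, cod d x.2 & U (param c x.1, param d x.2)]]
      (fun x => F (param c x.1) (param d x.2)).

End smooth_maps.

HB.mixin Record isLieGroup (R : realType) (n : nat) G
    of Manifold R n G & Group G := {
  mulg_smooth : smooth_on2 setT (fun x y : G => (x * y)%g);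
  invg_smooth : smooth_on setT (fun x : G => (x^-1)%g)
}.

#[short(type="lieGroupType")]
HB.structure Definition LieGroup (R : realType) (n : nat) :=
  {G of Manifold R n G & Group G & isLieGroup R n G}.

(* The tangent space at p of an n-manifold is R^n: a tangent vector is given by
   its components in the chart [chart_at p].  In particular the Lie algebra
   T_1 G of a Lie group of dimension k is R^k. *)
Section tangent.
Context {R : realType}.

Definition tangent_map (m n : nat) (M : manifoldType R m)
    (N : manifoldType R n) (F : M -> N) (p : M) : 'rV[R]_m -> 'rV[R]_n :=
  'd (chart_at (F p) \o F \o param (chart_at p)) (chart_at p p).

Definition velocity (m : nat) (M : manifoldType R m) (f : R -> M) (t : R) :
    'rV[R]_m :=
  derive1 (chart_at (f t) \o f) t.

(* The tangent vector at [param c x] with components v in the chart c. *)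
Definition chart_vector (m : nat) (M : manifoldType R m) (c : chart R m M)
    (x v : 'rV[R]_m) : 'rV[R]_m :=
  'd (chart_at (param c x) \o param c) x v.

(* A form is smooth when its components in every chart are. *)
Definition smooth_form (m k : nat) (M : manifoldType R m)
    (A : M -> {linear 'rV[R]_m -> 'rV[R]_k}) : Prop :=
  forall c : chart R m M, atlas c -> forall v,
    Cinfty (cod c) (fun x => A (param c x) (chart_vector c x v)).

End tangent.

Section bundles.
Context {R : realType} {m n k : nat}.
Context {M : manifoldType R m} {P : manifoldType R n} {G : lieGroupType R k}.
Implicit Types (pi : P -> M) (act : P -> G -> P).

(* p |-> (pi p, tau p) is a diffeomorphism from pi^-1(U) to U x G with inverse
   sigma, equivariant for the right translations of G on U x G. *)
Definition local_trivialization pi act (U : set M) (tau : P -> G)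
    (sigma : M -> G -> P) : Prop :=
  [/\ smooth_on (pi @^-1` U) tau,
      smooth_on2 (U `*` setT) sigma,
      forall p, U (pi p) -> sigma (pi p) (tau p) = p,
      forall x g, U x -> pi (sigma x g) = x /\ tau (sigma x g) = g &
      forall p g, U (pi p) -> tau (act p g) = (tau p * g)%g].

Record principal_bundle pi act : Prop := PrincipalBundle {
  pb_smooth : smooth_on setT pi;
  pb_act_smooth : smooth_on2 setT act;
  pb_act1 : forall p, act p 1%g = p;
  pb_actM : forall p g h, act p (g * h)%g = act (act p g) h;
  pb_pi_act : forall p g, pi (act p g) = pi p;
  pb_trivial : forall x, exists U tau sigma,
    [/\ open U, U x & local_trivialization pi act U tau sigma]
}.

Definition Ad (g : G) : 'rV[R]_k -> 'rV[R]_k :=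
  tangent_map (fun h : G => (g * h * g^-1)%g) 1%g.

(* The vertical vector d/dt (p exp(tX)) at t = 0. *)
Definition fundamental_vector act (X : 'rV[R]_k) (p : P) : 'rV[R]_n :=
  tangent_map (act p) 1%g X.

Record connection_form act (A : P -> {linear 'rV[R]_n -> 'rV[R]_k}) : Prop :=
ConnectionForm {
  cf_smooth : smooth_form A;
  cf_equivariant : forall p g v,
    A (act p g) (tangent_map (act^~ g) p v) = Ad (g^-1)%g (A p v);
  cf_vertical : forall p X, A p (fundamental_vector act X p) = X
}.

End bundles.

(* A curve [t0, t1] -> T, given by a function on the whole line whose values
   outside [t0, t1] are junk. *)
Record pcurve (R : realType) (T : Type) := PCurve {
  t0 : R;
  t1 : R;
  t0_lt_t1 : t0 < t1;
  pcurve_fun :> R -> T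
}.

HB.instance Definition _ (R : realType) (T : Type) := gen_eqMixin (pcurve R T).
HB.instance Definition _ (R : realType) (T : Type) :=
  gen_choiceMixin (pcurve R T).

Section curves.
Context {R : realType} {T : Type}.
Implicit Types c d : pcurve R T.

(* Equality on the parameter interval up to a translation of time. *)
Definition translate c d : bool :=
  `[< exists a : R, [/\ t0 d = t0 c - a, t1 d = t1 c - a &
        forall t, t0 d <= t <= t1 d -> d t = c (t + a)] >].

Lemma translate_refl : reflexive translate.
Proof.
by move=> c; apply/asboolP; exists 0; rewrite !subr0; split=> // t _; rewrite addr0.
Qed.

Lemma translate_impl c d : translate c d -> translate d c.
Proof.
move=> /asboolP[a [e0 e1 e]]; apply/asboolP; exists (- a).
rewrite e0 e1 !opprK !subrK; split=> // t /andP[h0 h1].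
by rewrite e ?subrK// e0 e1 !lerD2r h0.
Qed.

Lemma translate_sym : symmetric translate.
Proof. by move=> c d; apply/idP/idP; exact: translate_impl. Qed.

Lemma translate_trans : transitive translate.
Proof.
move=> d c e /asboolP[a [e0 e1 ea]] /asboolP[b [f0 f1 fb]].
apply/asboolP; exists (a + b); rewrite f0 f1 e0 e1 !opprD !addrA; split=> //.
move=> t /andP[h0 h1]; rewrite fb; last by rewrite f0 f1 e0 e1 h0.
by rewrite ea ?addrA 1?[t + a + b]addrAC// e0 e1 -lerBlDr h0 -lerBrDr h1.
Qed.

Canonical translate_equiv :=
  EquivRel translate translate_refl translate_sym translate_trans.

End curves.

Definition curve (R : realType) (T : Type) := {eq_quot (@translate R T)}.

Section curve_operations.
Context {R : realType}.

Definition curve_class (T : Type) (c : pcurve R T) : curve R T :=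
  \pi_(curve R T) c.

Definition curve_start (T : Type) (q : curve R T) : T := repr q (t0 (repr q)).

Definition pcurve_map (T T' : Type) (f : T -> T') (c : pcurve R T) :
  pcurve R T' := PCurve (t0_lt_t1 c) (f \o c).

Definition curve_map (T T' : Type) (f : T -> T') (q : curve R T) :
  curve R T' := curve_class (pcurve_map f (repr q)).

Lemma curve_classP (T : Type) (c d : pcurve R T) :
  curve_class c = curve_class d <-> translate c d.
Proof. by split => [/eqmodP|/eqmodP]. Qed.

Lemma curve_startE (T : Type) (c : pcurve R T) :
  curve_start (curve_class c) = c (t0 c).
Proof.
have /curve_classP/asboolP[a [e0 e1 e]] :
  curve_class c = curve_class (repr (curve_class c)) by rewrite /curve_class reprK.
by rewrite /curve_start e ?e0 ?subrK// -e0 lexx ltW// t0_lt_t1.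
Qed.

Lemma curve_mapE (T T' : Type) (f : T -> T') (c : pcurve R T) :
  curve_map f (curve_class c) = curve_class (pcurve_map f c).
Proof.
have /curve_classP/asboolP[a [e0 e1 e]] :
  curve_class (repr (curve_class c)) = curve_class c by rewrite /curve_class reprK.
apply/curve_classP/asboolP; exists a; split=> //= t ht.
by rewrite /= e.
Qed.

End curve_operations.

Section paths.
Context {R : realType}.

Definition smooth_path (m : nat) (M : manifoldType R m) (c : pcurve R M) :
    Prop :=
  [/\ exists W : set R^o, [/\ open W, `[t0 c, t1 c] `<=` W &
        smooth_into W (c : R^o -> M)],
      \forall t \near (t0 c)^'+, c t = c (t0 c) &
      \forall t \near (t1 c)^'-, c t = c (t1 c)].

Definition horizontal (n k : nat) (P : manifoldType R n)
    (A : P -> {linear 'rV[R]_n -> 'rV[R]_k}) (c : pcurve R P) : Prop :=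
  forall t, t0 c <= t <= t1 c -> A (c t) (velocity c t) = 0.

(* A class belongs to one of the two sets below as soon as one of its
   representatives has the required properties, so that the values outside
   [t0, t1] can be chosen to extend the path smoothly past the endpoints. *)
Definition paths (m : nat) (M : manifoldType R m) : set (curve R M) :=
  [set curve_class c | c in @smooth_path m M].

Definition hpaths (n k : nat) (P : manifoldType R n)
    (A : P -> {linear 'rV[R]_n -> 'rV[R]_k}) : set (curve R P) :=
  [set curve_class c | c in [set c | smooth_path c /\ horizontal A c]].

End paths.

Section horizontal_lift.
Context {R : realType} {m n k : nat}.
Context {M : manifoldType R m} {P : manifoldType R n} {G : lieGroupType R k}.
Context (pi : P -> M) (act : P -> G -> P).
Context (A : P -> {linear 'rV[R]_n -> 'rV[R]_k}).

Definition ev0_pullback : set (curve R M * P) :=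
  [set x | paths x.1 /\ curve_start x.1 = pi x.2].

Definition ev0_act (x : curve R M * P) (g : G) : curve R M * P :=
  (x.1, act x.2 g).

Definition pi0 (x : curve R M * P) : curve R M := x.1.

Definition piA : curve R P -> curve R M := curve_map pi.

Definition hpath_act (q : curve R P) (g : G) : curve R P :=
  curve_map (act^~ g) q.

Definition is_horizontal_lift (gamma : curve R M) (p : P) (q : curve R P) :
    Prop :=
  [/\ hpaths A q, curve_start q = p & piA q = gamma].

(* Definite description; the constant path is the default value. *)
Definition horizontal_lift (gamma : curve R M) (p : P) : curve R P :=
  xget (curve_class (PCurve ltr01 (fun=> p))) (is_horizontal_lift gamma p).

Definition mu (x : curve R M * P) : curve R P := horizontal_lift x.1 x.2.

End horizontal_lift.

(* Main.v *)
From HB Require Import structures.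
Require Import Defs.
From mathcomp Require Import all_boot all_order all_algebra.
From mathcomp Require Import all_classical all_reals all_analysis.
From mathcomp Require Import ring lra.

(* Write a lift of gamma as c = s g, where s is a local section along gamma and g
   a curve in G.  The connection form gives
     A(c') = Ad(g^-1) A(s') + g^-1 g',
   so c is horizontal exactly when g' = - dR_g A(s').  In the chart of G at 1
   this equation is locally solvable by Picard iteration, and its solutions are
   smooth by bootstrapping.  If s is itself horizontal the equation reads g' = 0,
   so two horizontal lifts of the same curve differ locally by a constant element
   of G.  Hence local lifts can be translated by G so as to be glued along the
   interval, and a global lift is determined by its initial point.  Where gamma is
   constant, so is its lift, by comparison with the constant curve.  Equivariance
   and bijectivity of mu follow from existence and uniqueness, since right
   translations preserve horizontality and q is the lift of pi q from its initial
   point. *)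

Set Implicit Arguments.
Unset Strict Implicit.
Unset Printing Implicit Defensive.

Import Order.TTheory GRing.Theory Num.Theory.
Import numFieldNormedType.Exports.

Local Open Scope classical_set_scope.
Local Open Scope ring_scope.

(** * Differential calculus of curves *)

(** Two obstacles shape the proof. Each tangent space is read in its own chart [chart_at p], so the
    components of a velocity may jump along a smooth curve; whatever concerns their dependence on
    time is first moved to one fixed chart. Moreover, compactness of the interval does not by itself
    turn local solutions into a global one, as the time of existence could shrink with the initial
    value. Here one local solution, issued from 1 in G, serves every point of a fibre after
    translation by G, so the time of existence depends on the instant alone. Paths are extended by
    constants to the whole line, so that derivatives at the endpoints are two-sided like all
    others. *)

Section curve_derivatives.
Context {R : realType}.

(** One direction suffices for curves, where [Ck] ranges over all of them. Only the existence of
    derivatives is recorded, so the closure properties are inductions on the Leibniz and chain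
    rules; the price is one order on the way back to [Ck], in [Dk_Ck]. *)
Fixpoint Dk (F : normedModType R) (k : nat) (U : set R) (f : R -> F) : Prop :=
  if k is j.+1 then (forall t, U t -> derivable f t 1) /\ Dk j U (derive1 f) else True.

Lemma near_derive1 (F : normedModType R) (f g : R -> F) (t : R) :
  (\forall u \near t, f u = g u) -> derive1 f t = derive1 g t.
Proof. by move=> fg; rewrite !derive1E; exact: near_eq_derive. Qed.

Lemma near_derivable (F : normedModType R) (f g : R -> F) (t : R) :
  (\forall u \near t, f u = g u) -> derivable f t 1 -> derivable g t 1.
Proof. by move=> fg; exact: near_eq_derivable. Qed.

Lemma derive1B (F : normedModType R) (f g : R -> F) (t : R) :
  derivable f t 1 -> derivable g t 1 ->
  derive1 (fun u => f u - g u) t = derive1 f t - derive1 g t.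
Proof. by move=> df dg; rewrite !derive1E deriveB. Qed.

Lemma eq_Dk (F : normedModType R) k (U : set R) (f g : R -> F) : open U ->
  (forall t, U t -> f t = g t) -> Dk k U f -> Dk k U g.
Proof.
move=> oU; elim: k f g => //= k IH f g fg [df Df].
have nfg t : U t -> \forall u \near t, f u = g u.
  by move=> Ut; apply: filterS (open_nbhs_nbhs (conj oU Ut)) => u; exact: fg.
split=> [t Ut|]; first exact: near_derivable (nfg _ Ut) (df _ Ut).
by apply: IH Df => t Ut; exact/near_derive1/nfg.
Qed.

Lemma sub_Dk (F : normedModType R) k (U V : set R) (f : R -> F) :
  V `<=` U -> Dk k U f -> Dk k V f.
Proof.
move=> VU; elim: k f => //= k IH f [df Df]; split; last exact: IH.
by move=> t /VU; exact: df.
Qed.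

Lemma Dk_local (F : normedModType R) k (U : set R) (f : R -> F) :
  (forall t, U t -> exists2 V, V t & Dk k V f) -> Dk k U f.
Proof.
elim: k f => //= k IH f Uf; split=> [t /Uf[V Vt [df _]]|]; first exact: df.
by apply: IH => t /Uf[V Vt [_ Df]]; exists V.
Qed.

Lemma DkW (F : normedModType R) k (U : set R) (f : R -> F) :
  Dk k.+1 U f -> Dk k U f.
Proof.
elim: k f => // k IH f [df Df]; split=> //; exact: IH.
Qed.

Lemma Dk_cst (F : normedModType R) k (U : set R) (a : F) : Dk k U (cst a).
Proof.
elim: k a => //= k IH a; split=> [t _|]; first exact: derivable_cst.
rewrite (_ : derive1 (cst a) = cst 0)//; apply/funext => t; exact: derive1_cst.
Qed.

Lemma DkD (F : normedModType R) k (U : set R) (f g : R -> F) : open U ->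
  Dk k U f -> Dk k U g -> Dk k U (fun t => f t + g t).
Proof.
move=> oU; elim: k f g => //= k IH f g [df Df] [dg Dg]; split.
  by move=> t Ut; apply: derivableD; [exact: df|exact: dg].
apply: eq_Dk (IH _ _ Df Dg) => // t Ut.
by rewrite !derive1E deriveD//; [exact: df|exact: dg].
Qed.

Lemma Dk_sum (F : normedModType R) k (U : set R) (I : Type) (r : seq I)
    (f : I -> R -> F) : open U ->
  (forall i, Dk k U (f i)) -> Dk k U (fun t => \sum_(i <- r) f i t).
Proof.
move=> oU Df; elim: r => [|i r IH].
  under eq_fun do rewrite big_nil. exact: Dk_cst.
under eq_fun do rewrite big_cons; exact: DkD.
Qed.

Lemma is_derive_scale (F : normedModType R) (h : R -> R) (f : R -> F) (t : R) :
  derivable h t 1 -> derivable f t 1 ->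
  is_derive t 1 (fun u => h u *: f u)
    ((derive1 h) t *: f t + h t *: (derive1 f) t).
Proof.
move=> dh df.
have hc : h (s *: 1 + t) @[s --> 0^'] --> h t.
  suff : {for 0, continuous (fun s : R => h (s *: 1 + t))}.
    by move=> /continuous_withinNx; rewrite scale0r add0r.
  exact/differentiable_continuous/derivable1_diffP/(derivable1P _ _ _).1.
suff H : s^-1 *: ((fun u => h u *: f u) (s *: 1 + t) - h t *: f t) @[s --> 0^']
    --> derive1 h t *: f t + h t *: derive1 f t.
  by apply: DeriveDef; [apply/cvg_ex; eexists; exact: H|exact: cvg_lim H].
(* The usual splitting of the increment of a product; [hc] takes care of the factor [h] in the
   second term. *)
rewrite [X in X @ _ --> _](_ : _ = fun s : R =>
   (s^-1 *: (h (s *: 1 + t) - h t)) *: f t +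
   h (s *: 1 + t) *: (s^-1 *: (f (s *: 1 + t) - f t))); last first.
  apply/funext => s.
  rewrite [s^-1 *: (_ - h t)]/(_ * _) -[(s^-1 * _) *: _]scalerA.
  rewrite [h _ *: (_ *: _)]scalerA [h _ * _]mulrC -scalerA -scalerDr.
  by congr (_ *: _); rewrite scalerBl scalerBr [RHS]addrC addrA subrK.
apply: cvgD.
  apply: cvgZr_tmp; rewrite derive1E; exact: dh.
apply: cvgZ => //; rewrite derive1E; exact: df.
Qed.

Lemma Dk_scale (F : normedModType R) k (U : set R) (h : R -> R) (f : R -> F) :
  open U -> Dk k U h -> Dk k U f -> Dk k U (fun t => h t *: f t).
Proof.
move=> oU; elim: k h f => //= k IH h f [dh Dh] [df Df].
have D t : U t -> _ := fun Ut => is_derive_scale (dh t Ut) (df t Ut).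
split=> [t /D[]//|].
have Dh' : Dk k U h by apply: DkW; split.
have Df' : Dk k U f by apply: DkW; split.
apply: eq_Dk (DkD oU (IH _ _ Dh Df') (IH _ _ Dh' Df)) => //.
by move=> t Ut; rewrite [RHS]derive1E; have [_ ->] := D t Ut.
Qed.

Lemma derive1_mx (n : nat) (f : R -> 'rV[R]_n) (t : R) i j :
  derivable f t 1 -> derive1 f t i j = derive1 (fun u => f u i j) t.
Proof. by move=> df; rewrite !derive1E derive_mx// mxE. Qed.

Lemma derivable_diff1 (F : normedModType R) (f : R -> F) (t : R) :
  derivable f t 1 -> 'd f t 1 = derive1 f t.
Proof. by move=> /derivable1_diffP df; rewrite derive1E deriveE. Qed.

Lemma derivable_pair (E F : normedModType R) (f : R -> E) (g : R -> F) t :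
  derivable f t 1 -> derivable g t 1 ->
  derivable (fun u => (f u, g u)) t 1 /\
  derive1 (fun u => (f u, g u)) t = (derive1 f t, derive1 g t).
Proof.
move=> df dg; have df' := (derivable1_diffP _ _).1 df.
have dg' := (derivable1_diffP _ _).1 dg.
split; first exact/derivable1_diffP/differentiable_pair.
rewrite -derivable_diff1; last exact/derivable1_diffP/differentiable_pair.
by rewrite diff_pair//= !derivable_diff1.
Qed.

Lemma Dk_pair (E F : normedModType R) k (U : set R) (f : R -> E) (g : R -> F) :
  open U -> Dk k U f -> Dk k U g -> Dk k U (fun t => (f t, g t)).
Proof.
move=> oU; elim: k f g => //= k IH f g [df Df] [dg Dg]; split=> [t Ut|].
  by apply: (derivable_pair _ _).1; [exact: df|exact: dg].
apply: eq_Dk (IH _ _ Df Dg) => // t Ut.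
by rewrite (derivable_pair _ _).2//; [exact: df|exact: dg].
Qed.

Lemma is_derive_compd (E F : normedModType R) (g : E -> F) (f : R -> E) t :
  differentiable g (f t) -> derivable f t 1 ->
  derivable (g \o f) t 1 /\ derive1 (g \o f) t = 'd g (f t) (derive1 f t).
Proof.
move=> dg df; have df' := (derivable1_diffP _ _).1 df.
have dgf : derivable (g \o f) t 1.
  exact/derivable1_diffP/differentiable_comp.
by split=> //; rewrite -derivable_diff1// diff_comp//= derivable_diff1.
Qed.

End curve_derivatives.

(* [Ck] speaks of directional derivatives only: in a finite basis the
   differential is recovered from finitely many of them. *)
Record fbasis (R : realType) (E : normedModType R) := FBasis {
  bidx : finType;
  bvec : bidx -> E;
  bcoord : bidx -> E -> R;
  bcoord_linear : forall i, linear (bcoord i : E -> R);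
  bcoord_le : forall i x, `|bcoord i x| <= `|x|;
  bdecomp : forall x, x = \sum_i bcoord i x *: bvec i
}.

Section fbasis_theory.
Context {R : realType}.

Lemma rV_norm_coord n (i : 'I_n) (x : 'rV[R]_n) : `|x 0 i| <= `|x|.
Proof.
rewrite {2}/Num.norm/= mx_normrE.
exact: (le_bigmax _ (fun ij : 'I_1 * 'I_n => `|x ij.1 ij.2|) (0, i)).
Qed.

Lemma rV_norm_le n (x : 'rV[R]_n) (e : R) : 0 <= e ->
  (forall i, `|x 0 i| <= e) -> `|x| <= e.
Proof.
move=> e0 xe; rewrite {1}/Num.norm/= mx_normrE.
by apply/bigmax_leP; split=> // -[i j] _ /=; rewrite ord1.
Qed.

Lemma rV_decomp n (x : 'rV[R]_n) : x = \sum_i x 0 i *: delta_mx 0 i.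
Proof. exact: row_sum_delta. Qed.

Lemma rV_coord_linear n (i : 'I_n) : linear (fun x : 'rV[R]_n => x 0 i : R).
Proof. by move=> a x y; rewrite !mxE. Qed.

Definition rV_fbasis n : fbasis 'rV[R]_n :=
  @FBasis R 'rV[R]_n 'I_n (delta_mx 0) (fun i x => x 0 i)
    (@rV_coord_linear n) (@rV_norm_coord n) (@rV_decomp n).

Context {E F : normedModType R} (b : fbasis E) (c : fbasis F).

Definition pair_coord (k : bidx b + bidx c) (x : E * F) : R :=
  match k with inl i => bcoord i x.1 | inr i => bcoord i x.2 end.

Definition pair_vec (k : bidx b + bidx c) : E * F :=
  match k with inl i => (bvec i, 0) | inr i => (0, bvec i) end.

Lemma pair_coord_linear k : linear (pair_coord k : E * F -> R).
Proof. by move=> a x y; case: k => i /=; rewrite bcoord_linear. Qed.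

Lemma pair_coord_le k x : `|pair_coord k x| <= `|x|.
Proof.
by rewrite prod_normE le_max; case: k => i /=; rewrite bcoord_le ?orbT.
Qed.

Lemma pair_decomp x : x = \sum_k pair_coord k x *: pair_vec k.
Proof.
rewrite big_sumType/=; case: x => x y /=.
have H1 (I : finType) (f : I -> E) :
    \sum_i ((f i, 0) : E * F) = (\sum_i f i, 0).
  elim/big_rec2: _ => //= i u v _ ->.
  by rewrite /GRing.add/= /add_pair/= addr0.
have H2 (I : finType) (f : I -> F) :
    \sum_i ((0, f i) : E * F) = (0, \sum_i f i).
  elim/big_rec2: _ => //= i u v _ ->.
  by rewrite /GRing.add/= /add_pair/= addr0.
under eq_bigr do rewrite /GRing.scale/= /scale_pair/= scaler0.
under [X in _ + X]eq_bigr do rewrite /GRing.scale/= /scale_pair/= scaler0.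
rewrite H1 H2 -!bdecomp /GRing.add/= /add_pair/=.
by rewrite addr0 add0r.
Qed.

Definition pair_fbasis : fbasis (E * F)%type :=
  FBasis pair_coord_linear pair_coord_le pair_decomp.

End fbasis_theory.

(** * Smooth curves in normed spaces and their images under smooth maps *)

Section smooth_curves.
Context {R : realType}.

HB.instance Definition _ (E : normedModType R) (b : fbasis E) i :=
  @GRing.isLinear.Build R E R _ (@bcoord R E b i) (bcoord_linear i).

Lemma bcoord_continuous (E : normedModType R) (b : fbasis E) i :
  continuous (@bcoord R E b i).
Proof.
apply/linear_bounded_continuous; apply/linear_boundedP; near=> r => y.
by rewrite (le_trans (bcoord_le _ _))// ler_peMl.
Unshelve. all: by end_near. Qed.

Lemma bcoord_differentiable (E : normedModType R) (b : fbasis E) i x :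
  differentiable (@bcoord R E b i) x.
Proof.
exact/linear_differentiable/bcoord_continuous. Qed.

Lemma diff_basis (E F : normedModType R) (b : fbasis E) (g : E -> F) x v :
  differentiable g x ->
  'd g x v = \sum_i bcoord i v *: 'D_(@bvec R E b i) g x.
Proof.
move=> dg; rewrite {1}[v](bdecomp b) linear_sum; apply: eq_bigr => i _.
by rewrite linearZ deriveE.
Qed.

Lemma Dk_bcoord (E : normedModType R) (b : fbasis E) i k U (f : R -> E) :
  open U -> Dk k U f -> Dk k U (fun t => @bcoord R E b i (f t)).
Proof.
move=> oU; elim: k f => //= k IH f [df Df].
have H t (Ut : U t) := is_derive_compd (bcoord_differentiable i (f t)) (df t Ut).
split=> [t /H[]//|].
apply: eq_Dk (IH _ Df) => // t /H[_ ->].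
rewrite diff_lin//; exact: bcoord_continuous.
Qed.

(** By the chain rule, the derivative of [g \o f] is a sum of coordinates of the derivative of [f]
    times derivatives of [g] along the fixed basis vectors, taken at [f]. The latter are of one
    class less by the very definition of [Ck], so the induction hypothesis covers them. *)
Lemma Dk_comp (E F : normedModType R) (b : fbasis E) k U V (f : R -> E)
    (g : E -> F) : open U -> (forall t, U t -> V (f t)) ->
  Ck k V g -> Dk k U f -> Dk k U (g \o f).
Proof.
move=> oU UV; elim: k f g UV => //= k IH f g UV [dg Dg] [df Df].
have H t (Ut : U t) := is_derive_compd (dg _ (UV t Ut)) (df t Ut).
split=> [t /H[]//|].
apply: eq_Dk (_ : Dk k U (fun t => \sum_i @bcoord R E b i (derive1 f t) *:
  ('D_(bvec i) g \o f) t)) => // [t Ut|].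
  by rewrite (H t Ut).2 -diff_basis//; exact/dg/UV.
apply: Dk_sum => // i; apply: Dk_scale => //; first exact: Dk_bcoord.
by apply: IH => //; apply: DkW; split.
Qed.

Lemma sub_Ck (E F : normedModType R) k (U V : set E) (f : E -> F) :
  V `<=` U -> Ck k U f -> Ck k V f.
Proof.
move=> VU; elim: k f => /= [f cf x /VU|k IH f [df Df]]; first exact: cf.
by split=> [x /VU|v]; [exact: df|exact: IH].
Qed.

Lemma Ck_curve (F : normedModType R) k (U : set R) (f : R -> F) : open U ->
  Ck k (U : set R^o) (f : R^o -> F) -> Dk k U f.
Proof.
move=> oU; elim: k f => //= k IH f [df Df]; split.
  by move=> t Ut; apply/derivable1_diffP/df.
have /IH := Df 1; apply: eq_Dk => // t Ut; by rewrite derive1E.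
Qed.

Lemma Ck_eq_curve (F : normedModType R) k (U : set R) (f g : R -> F) : open U ->
  (forall t, U t -> f t = g t) ->
  Ck k (U : set R^o) (f : R^o -> F) -> Ck k (U : set R^o) (g : R^o -> F).
Proof.
move=> oU; elim: k f g => /= [|k IH] f g fg.
  move=> cf x Ux; rewrite /prop_for /continuous_at -fg//.
  apply: cvg_trans (cf x Ux); apply: near_eq_cvg.
  by apply: filterS (open_nbhs_nbhs (conj oU Ux)) => u /fg.
have nfg t : U t -> \forall u \near t, f u = g u.
  by move=> Ut; apply: filterS (open_nbhs_nbhs (conj oU Ut)) => u; exact: fg.
move=> [df Df]; split=> [t Ut|v].
  apply/derivable1_diffP; apply: near_derivable (nfg _ Ut) _.
  exact/derivable1_diffP/df.
apply: IH (Df v) => t Ut; apply: near_eq_derive; exact: nfg.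
Qed.

(** The extra order provides the continuity of the last derivative. On [R^o] the derivative along v
    is v times the ordinary one. *)
Lemma Dk_Ck (F : normedModType R) k (U : set R) (f : R -> F) : open U ->
  Dk k.+1 U f -> Ck k (U : set R^o) (f : R^o -> F).
Proof.
move=> oU; elim: k f => [|k IH] f.
  move=> [df _] t Ut; exact/differentiable_continuous/derivable1_diffP/df.
move=> [df Df]; split=> [t Ut|v].
  exact/derivable1_diffP/df.
apply: Ck_eq_curve (IH _ (_ : Dk k.+1 U (fun t => v *: derive1 f t))) => //.
  move=> t Ut; rewrite deriveE; last exact/derivable1_diffP/df.
  rewrite diff1E//; exact/derivable1_diffP/df.
by apply: Dk_scale => //; exact: Dk_cst.
Qed.

Lemma Dk_line (F : normedModType R) k (U : set R) (x v : F) : Dk k U (fun t => x + t *: v).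
Proof.
apply: (sub_Dk (@subsetT _ U)); have oT : open [set: R] by exact: openT.
apply: (DkD oT (Dk_cst k setT x)).
apply: (Dk_scale oT (h := id) _ (Dk_cst k setT v)).
case: k => //= k; split=> [*|]; first exact: derivable_id.
rewrite (_ : derive1 (id : R -> R) = cst (1 : R)); last first.
  by apply/funext => t; exact: derive1_id.
exact: Dk_cst.
Qed.

Lemma derivable_line (F : normedModType R) (x v : F) (t : R) :
  derivable (fun t : R => x + t *: v) t 1.
Proof. by have [dl _] := Dk_line 1 setT x v; exact: dl. Qed.

Lemma derive1_line (F : normedModType R) (x v : F) (t : R) :
  derive1 (fun t => x + t *: v) t = v.
Proof.
have did : derivable (id : R -> R) t 1 by exact: derivable_id.
have dcv : derivable (cst v : R -> _) t 1 by exact: derivable_cst.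
have [d1] := is_derive_scale did dcv.
rewrite (_ : derive1 id t = 1 :> R); last exact: derive1_id.
rewrite derive1_cst scaler0 addr0 scale1r => dv.
have dcx : derivable (cst x : R -> _) t 1 by exact: derivable_cst.
rewrite derive1E; apply: etrans (deriveD dcx d1) _.
by rewrite dv derive_cst add0r.
Qed.

End smooth_curves.

(** * Mean value inequalities *)

Section mean_value.
Context {R : realType}.

(** The norm on row vectors is the sup norm, so the scalar mean value theorem in each coordinate
    gives the bound with the same constant. *)
Lemma rV_mvt_le n (f : R -> 'rV[R]_n) (K a b : R) : 0 <= K -> a <= b ->
  (forall t, a <= t <= b -> derivable f t 1 /\ `|derive1 f t| <= K) ->
  `|f b - f a| <= K * (b - a).
Proof.
move=> K0 ab fK; apply: rV_norm_le => [|i]; first by rewrite mulr_ge0// subr_ge0.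
have dfi t : a <= t <= b -> derivable (fun u => f u 0 i) t 1.
  by move=> /fK[/derivable_mxP].
have [||c] := @MVT_segment R (fun u => f u 0 i)
    (derive1 (fun u => f u 0 i)) a b ab.
- move=> x /[!in_itv]/= /andP[ax xb]; rewrite derive1E; apply: derivableP.
  by apply: dfi; rewrite !ltW.
- apply: derivable_within_continuous => x /[!in_itv]/=; exact: dfi.
rewrite in_itv/= => cab fc.
rewrite !mxE fc normrM (ger0_norm (_ : 0 <= b - a)) ?subr_ge0//.
rewrite ler_wpM2r ?subr_ge0//; have [df dfK] := fK _ cab.
by rewrite -derive1_mx// (le_trans _ dfK)// rV_norm_coord.
Qed.

Lemma rV_mvt_lipschitz n (f : R -> 'rV[R]_n) (K a b : R) : 0 <= K ->
  (forall t, Num.min a b <= t <= Num.max a b ->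
     derivable f t 1 /\ `|derive1 f t| <= K) ->
  `|f b - f a| <= K * `|b - a|.
Proof.
move=> K0; have [ab|/ltW ba] := leP a b => fK.
  by rewrite (ger0_norm (_ : 0 <= b - a)) ?subr_ge0//; exact: rV_mvt_le.
by rewrite distrC (distrC b) (ger0_norm (_ : 0 <= a - b)) ?subr_ge0//;
  exact: rV_mvt_le.
Qed.

Lemma near_derive0_cst n (f : R -> 'rV[R]_n) (t : R) :
  (\forall u \near t, derivable f u 1 /\ derive1 f u = 0) ->
  \forall u \near t, f u = f t.
Proof.
move=> /nbhs_ballP[r /= r0 rf]; apply/nbhs_ballP; exists r => //= u tu.
apply/eqP; rewrite -subr_eq0 -normr_le0 -(mul0r `|u - t|).
apply: rV_mvt_lipschitz => // v; rewrite -ball_normE/= in tu => tv.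
have /rf[dv ->] : ball t r v.
  rewrite -ball_normE/=; move: tu tv; rewrite !ltr_norml.
  by case: (leP t u) => _ /andP[? ?] /andP[? ?]; apply/andP; split; lra.
by rewrite normr0.
Qed.

End mean_value.

Section near_differentiable.
Context {R : realType} {E F : normedModType R}.

Lemma near_eq_differentiable (f g : E -> F) (x : E) :
  (\forall y \near x, f y = g y) -> differentiable f x -> differentiable g x.
Proof.
move=> fg df; have [cdf fE] := (diff_locallyP _ _).1 df.
have gE : g \o shift x = cst (g x) + 'd f x +o_ (0 : E) id.
  apply/eqaddoP => _/posnumP[e]; have := fE => /eqaddoP/(_ e%:num (gt0 e)).
  have fg0 : \forall y \near (0 : E), f (y + x) = g (y + x).
    by have := fg; rewrite (near_shift 0) subr0.
  apply: filterS2 fg0 => y fgy.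
  by rewrite /= /GRing.add/= /GRing.opp/= -(nbhs_singleton fg) fgy.
apply/diff_locallyP; rewrite (diff_unique cdf gE); split=> //.
Qed.

End near_differentiable.

(** * Curves on manifolds *)

Section smooth_at.
Context {R : realType}.

(* One chart suffices, as transition maps are smooth: see [smooth_atP]. *)
Definition smooth_at (n : nat) (N : manifoldType R n) (c : R -> N) (t : R) :=
  exists (e : chart R n N) (V : set R), [/\ atlas e, open V, V t,
    forall u, V u -> dom e (c u) & forall k, Dk k V (e \o c)].

Lemma nbhs_open (T : topologicalType) (x : T) (S : set T) : nbhs x S ->
  exists B, [/\ open B, B x & B `<=` S].
Proof. by rewrite nbhsE => -[B [oB Bx] BS]; exists B. Qed.

Context {n : nat} {N : manifoldType R n}.

Lemma near_eq_continuous_at (S T : topologicalType) (f g : S -> T) (x : S) :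
  (\forall y \near x, f y = g y) -> {for x, continuous f} ->
  {for x, continuous g}.
Proof.
move=> fg cf; rewrite /prop_for /continuous_at -(nbhs_singleton fg).
by apply: cvg_trans cf; apply: near_eq_cvg.
Qed.

Lemma smooth_at_near (c : R -> N) (t : R) : smooth_at c t ->
  \forall u \near t, smooth_at c u.
Proof.
move=> [e [V [ae oV Vt eV DV]]].
by apply: filterS (open_nbhs_nbhs (conj oV Vt)) => u Vu; exists e, V.
Qed.

Lemma smooth_at_continuous (c : R -> N) (t : R) : smooth_at c t ->
  {for t, continuous c}.
Proof.
move=> [e [V [ae oV Vt eV DV]]].
have ce : {for t, continuous (param e \o (e \o c))}.
  apply: continuous_comp.
    have [dc _] := DV 1%N.
    exact/differentiable_continuous/derivable1_diffP/dc.
  exact/param_continuous/coord_cod/eV.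
apply: near_eq_continuous_at ce.
apply: filterS (open_nbhs_nbhs (conj oV Vt)) => u Vu /=.
by rewrite coordK//; exact: eV.
Qed.

Lemma smooth_at_eq (c d : R -> N) (t : R) :
  (\forall u \near t, c u = d u) -> smooth_at c t -> smooth_at d t.
Proof.
move=> /nbhs_open[B [oB Bt cd]] [e [V [ae oV Vt eV DV]]].
exists e, (V `&` B); split=> //; first exact: openI.
  by move=> u [Vu Bu]; rewrite -cd//; exact: eV.
move=> k; apply: eq_Dk (sub_Dk (@subIsetl _ _ _) (DV k)); first exact: openI.
by move=> u [_ Bu] /=; rewrite cd.
Qed.

(** Near t, [e \o c] is a transition map applied to the expression of [c] in the chart that
    witnesses smoothness. One neighbourhood serves all orders, which is what [smooth_at] asks
    for. *)
Lemma smooth_at_chart (c : R -> N) (t : R) (e : chart R n N) :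
  smooth_at c t -> atlas e -> dom e (c t) ->
  exists V : set R, [/\ open V, V t, forall u, V u -> dom e (c u) &
    forall k, Dk k V (e \o c)].
Proof.
move=> sc; have cc := smooth_at_continuous sc.
case: sc => [d [V [ad oV Vt dV DV]]] ae ect.
have /nbhs_open[B [oB Bt Be]] : nbhs t (c @^-1` dom e).
  by apply: cc; apply: open_nbhs_nbhs; split=> //; exact: open_dom.
exists (V `&` B); split=> //; first exact: openI.
  by move=> u [_ /Be].
move=> k; have oVB := openI oV oB.
have := transition_smooth _ _ ad ae k.
move=> /(Dk_comp (rV_fbasis n) oVB (f := d \o c)) H.
apply: eq_Dk oVB _ (H _ _) => [u [Vu _]|u [Vu Bu]|].
- by rewrite /= coordK//; exact: dV.
- split=> /=; first exact/coord_cod/dV.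
  by rewrite coordK//; [exact: Be|exact: dV].
exact: sub_Dk (@subIsetl _ _ _) (DV k).
Qed.

Lemma smooth_at_derivable (c : R -> N) (t : R) (e : chart R n N) :
  smooth_at c t -> atlas e -> dom e (c t) -> derivable (e \o c) t 1.
Proof.
by move=> sc ae et; have [V [_ Vt _ /(_ 1%N)[+ _]]] := smooth_at_chart sc ae et;
  exact.
Qed.

Lemma smooth_at_param (e : chart R n N) (y : R -> 'rV[R]_n) (V : set R) t :
  atlas e -> open V -> V t -> (forall u, V u -> cod e (y u)) ->
  (forall k, Dk k V y) -> smooth_at (param e \o y) t.
Proof.
move=> ae oV Vt yV DV; exists e, V; split=> // [u /yV|k]; first exact: param_dom.
by apply: eq_Dk (DV k) => // u /yV yu /=; rewrite paramK.
Qed.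

Lemma smooth_at_cst (a : N) t : smooth_at (cst a) t.
Proof.
exists (chart_at a), setT; split=> //; first exact: chart_at_atlas.
- exact: openT.
- by move=> *; exact: chart_at_dom.
- by move=> k; exact: (Dk_cst k setT (chart_at a a)).
Qed.

(** Any space with a finite basis is allowed as the source, to serve both single charts and the
    product charts of [smooth_on2]. *)
Lemma smooth_into_comp (E : normedModType R) (b : fbasis E) (W : set E)
    (f : E -> N) (x : R -> E) (V : set R) (t : R) :
  smooth_into W f -> open V -> V t -> (forall u, V u -> W (x u)) ->
  (forall k, Dk k V x) -> smooth_at (f \o x) t.
Proof.
move=> [cf sf] oV Vt xW DV; pose e := chart_at (f (x t)).
have xc : {for t, continuous x}.
  by have [dx _] := DV 1%N; exact/differentiable_continuous/derivable1_diffP/dx.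
have /nbhs_open[B [oB Bt Be]] : nbhs t ((f \o x) @^-1` dom e).
  apply: (continuous_comp xc (cf _ (xW _ Vt))).
  apply: open_nbhs_nbhs; split; [exact: open_dom|exact: chart_at_dom].
have oVB := openI oV oB.
exists e, (V `&` B); split=> //; first exact: chart_at_atlas.
  by move=> u [_ /Be].
move=> k; have := sf e (chart_at_atlas _) k.
move=> /(Dk_comp b oVB (f := x)); apply; last first.
  exact: sub_Dk (@subIsetl _ _ _) (DV k).
by move=> u [Vu /Be]; split=> //; exact: xW.
Qed.

Lemma smooth_atP (W : set R) (c : R -> N) : open W ->
  smooth_into (W : set R^o) (c : R^o -> N) <-> forall t, W t -> smooth_at c t.
Proof.
move=> oW; split=> [[cc sc] t Wt|sc].
  pose e := chart_at (c t).
  have /nbhs_open[B [oB Bt Be]] : nbhs t (c @^-1` dom e).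
    apply: cc => //; apply: open_nbhs_nbhs; split; first exact: open_dom.
    exact: chart_at_dom.
  exists e, (W `&` B); split=> //; first exact: chart_at_atlas.
  - exact: openI.
  - by move=> u [_ /Be].
  move=> k; have oWB := openI oW oB.
  apply: Ck_curve => //.
  apply: sub_Ck (sc e (chart_at_atlas _) k).
  by move=> u [Wu /Be].
split=> [t Wt|e ae k]; first exact/smooth_at_continuous/sc.
have oD : open (W `&` c @^-1` dom e).
  rewrite openE => t [Wt ct]; rewrite /interior; apply: filterI.
    exact: open_nbhs_nbhs.
  apply: (smooth_at_continuous (sc t Wt)).
  by apply: open_nbhs_nbhs; split=> //; exact: open_dom.
apply: (Dk_Ck oD); apply: Dk_local => t [Wt ct].
by have [V [oV Vt _ DV]] := smooth_at_chart (sc t Wt) ae ct; exists V.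
Qed.

End smooth_at.

(** * Velocities and changes of chart *)

Section velocity.
Context {R : realType}.

(** The chart expression has junk values where [F] leaves the chart at [F p]; continuity ensures
    that this does not happen near p, so that differentials can be composed. *)
Definition mdiff (m n : nat) (M : manifoldType R m) (N : manifoldType R n)
    (F : M -> N) (p : M) : Prop :=
  {for p, continuous F} /\
  differentiable (chart_at (F p) \o F \o param (chart_at p)) (chart_at p p).

Context {l m n : nat} {L : manifoldType R l} {M : manifoldType R m}
  {N : manifoldType R n}.

Lemma chart_at_cod (p : M) : cod (chart_at p) (chart_at p p).
Proof. exact/coord_cod/chart_at_dom. Qed.

Lemma near_dom (c : R -> M) t (e : chart R m M) : smooth_at c t ->
  dom e (c t) -> \forall u \near t, dom e (c u).
Proof.
move=> /smooth_at_continuous cc et; apply: cc.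
by apply: open_nbhs_nbhs; split=> //; exact: open_dom.
Qed.

Lemma near_dom_chart_at (p : M) : nbhs p (dom (chart_at p)).
Proof.
by apply: open_nbhs_nbhs; split; [exact: open_dom|exact: chart_at_dom].
Qed.

Lemma smooth_at_derivable_chart_at (c : R -> M) t : smooth_at c t ->
  derivable (chart_at (c t) \o c) t 1.
Proof.
by move=> sc; apply: smooth_at_derivable => //;
  [exact: chart_at_atlas|exact: chart_at_dom].
Qed.

Lemma velocity_eq (c d : R -> M) t : (\forall u \near t, c u = d u) ->
  velocity c t = velocity d t.
Proof.
move=> cd; rewrite /velocity (nbhs_singleton cd); apply: near_derive1.
by apply: filterS cd => u /= ->.
Qed.

Lemma velocity_cst (p : M) t : velocity (cst p) t = 0.
Proof. exact: (derive1_cst (chart_at p p) t). Qed.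

Lemma velocity_comp (F : M -> N) (c : R -> M) t : mdiff F (c t) ->
  smooth_at c t -> velocity (F \o c) t = tangent_map F (c t) (velocity c t).
Proof.
move=> [_ dF] sc; have [_ H] :=
  is_derive_compd (f := chart_at (c t) \o c) dF (smooth_at_derivable_chart_at sc).
apply: etrans H; apply: near_derive1.
have := near_dom sc (chart_at_dom (c t)); apply: filterS => u du /=.
by rewrite coordK.
Qed.

(** Trades the chart of [velocity], which moves with the point, for a chart [e] fixed along the
    curve; [derive_chart_velocity] is the inverse passage. *)
Lemma velocity_chart_vector (c : R -> M) t (e : chart R m M) :
  smooth_at c t -> atlas e -> dom e (c t) ->
  velocity c t = chart_vector e (e (c t)) (derive1 (e \o c) t).
Proof.
move=> sc ae et; rewrite /chart_vector.
have ke := coordK et.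
have dp : differentiable (chart_at (c t) \o param e) (e (c t)).
  apply: (transition_smooth _ _ ae (chart_at_atlas (c t)) 1%N).1; split.
    exact: coord_cod.
  by rewrite /= ke; exact: chart_at_dom.
rewrite ke; have [_ <-] :=
  is_derive_compd (f := e \o c) dp (smooth_at_derivable sc ae et).
apply: near_derive1; have := near_dom sc et; apply: filterS => u du /=.
by rewrite coordK.
Qed.

Lemma derive_chart_velocity (c : R -> M) t (e : chart R m M) :
  smooth_at c t -> atlas e -> dom e (c t) ->
  derive1 (e \o c) t =
    'd (e \o param (chart_at (c t))) (chart_at (c t) (c t)) (velocity c t).
Proof.
move=> sc ae et; have kc := coordK (chart_at_dom (c t)).
have dp : differentiable (e \o param (chart_at (c t))) (chart_at (c t) (c t)).
  apply: (transition_smooth _ _ (chart_at_atlas (c t)) ae 1%N).1; split.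
    exact/coord_cod/chart_at_dom.
  by rewrite /= kc.
have [_ <-] := is_derive_compd (f := chart_at (c t) \o c) dp
  (smooth_at_derivable_chart_at sc).
apply: near_derive1.
have := near_dom sc (chart_at_dom (c t)); apply: filterS => u du /=.
by rewrite coordK.
Qed.

(** In the chart at [c t], kept fixed, the derivative at nearby times is a linear image of the
    velocity, hence zero. *)
Lemma velocity0_cst (c : R -> M) t :
  (\forall u \near t, smooth_at c u /\ velocity c u = 0) ->
  \forall u \near t, c u = c t.
Proof.
move=> c0; have sc := (nbhs_singleton c0).1.
have nd := near_dom sc (chart_at_dom (c t)).
have ed : \forall u \near t, (chart_at (c t) \o c) u = (chart_at (c t) \o c) t.
  apply: near_derive0_cst; apply: filterS2 nd c0 => u du [su vu].
  split; first by apply: smooth_at_derivable => //; exact: chart_at_atlas.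
  rewrite derive_chart_velocity//; last exact: chart_at_atlas.
  by rewrite vu linear0.
apply: filterS2 nd ed => u du /= eu.
by rewrite -(coordK du) eu coordK//; exact: chart_at_dom.
Qed.

(** A curve through p with prescribed velocity v; only its germ at 0 is meaningful, as the segment
    may leave the chart. *)
Definition line (p : M) (v : 'rV[R]_m) (t : R) : M :=
  param (chart_at p) (chart_at p p + t *: v).

Lemma line0 p v : line p v 0 = p.
Proof. by rewrite /line scale0r addr0 coordK//; exact: chart_at_dom. Qed.

Lemma near_line_cod (p : M) v :
  \forall t \near (0 : R), cod (chart_at p) (chart_at p p + t *: v).
Proof.
have := @derivable_line R _ (chart_at p p) v 0.
move=> /derivable1_diffP/differentiable_continuous.
apply; rewrite scale0r addr0.
by apply: open_nbhs_nbhs; split; [exact: open_cod|exact: chart_at_cod].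
Qed.

Lemma smooth_at_line p v : smooth_at (line p v) 0.
Proof.
have /nbhs_open[B [oB B0 Be]] := near_line_cod p v.
apply: (@smooth_at_param _ _ _ (chart_at p) _ B) => //.
- exact: chart_at_atlas.
- by move=> k; exact: Dk_line.
Qed.

Lemma velocity_line p v : velocity (line p v) 0 = v.
Proof.
rewrite /velocity line0 -[RHS](derive1_line (chart_at p p) v 0).
apply: near_derive1; have := near_line_cod p v; apply: filterS => t et /=.
by rewrite paramK.
Qed.

End velocity.

(** * Smooth maps of one and two variables along curves *)

Section smooth_maps_along_curves.
Context {R : realType}.

Lemma mdiff_comp (l m n : nat) (L : manifoldType R l) (M : manifoldType R m)
    (N : manifoldType R n) (F : L -> M) (H : M -> N) (p : L) :
  mdiff F p -> mdiff H (F p) -> mdiff (H \o F) p.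
Proof.
move=> [cF dF] [cH dH]; split; first exact: continuous_comp.
set x := chart_at p p; rewrite /= in dH.
have xp : param (chart_at p) x = p by rewrite coordK//; exact: chart_at_dom.
have cx : cod (chart_at p) x by exact: chart_at_cod.
have dH' : differentiable (chart_at (H (F p)) \o H \o param (chart_at (F p)))
   ((chart_at (F p) \o F \o param (chart_at p)) x) by rewrite /= xp.
apply: near_eq_differentiable (differentiable_comp dF dH').
have cFp : {for x, continuous (F \o param (chart_at p))}.
  by apply: continuous_comp; [exact: param_continuous|rewrite xp].
have : nbhs x ((F \o param (chart_at p)) @^-1` dom (chart_at (F p))).
  by apply: cFp; rewrite /= xp; exact: near_dom_chart_at.
by apply: filterS => y /= dy; rewrite coordK.
Qed.

Lemma smooth_at_comp (m n : nat) (M : manifoldType R m) (N : manifoldType R n)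
    (U : set M) (F : M -> N) (c : R -> M) t :
  smooth_on U F -> smooth_at c t -> (\forall u \near t, U (c u)) ->
  smooth_at (F \o c) t.
Proof.
move=> sF [e [V [ae oV Vt eV DV]]] /nbhs_open[B [oB Bt UB]].
have := smooth_into_comp (rV_fbasis m) (sF e ae) (openI oV oB) (conj Vt Bt)
  (x := e \o c).
move=> /(_ _ (fun k => sub_Dk (@subIsetl _ _ _) (DV k))) H.
apply: smooth_at_eq (H _); last first.
  move=> u [Vu Bu]; split; first exact/coord_cod/eV.
  by rewrite /= coordK; [exact: UB|exact: eV].
apply: filterS (open_nbhs_nbhs (conj oV Vt)) => u Vu /=.
by rewrite coordK//; exact: eV.
Qed.

Context {l m n : nat} {L : manifoldType R l} {M : manifoldType R m}
  {N : manifoldType R n}.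

Lemma smooth_at_comp2 (U : set (L * M)) (F : L -> M -> N) (a : R -> L)
    (b : R -> M) t :
  smooth_on2 U F -> smooth_at a t -> smooth_at b t ->
  (\forall u \near t, U (a u, b u)) -> smooth_at (fun u => F (a u) (b u)) t.
Proof.
move=> sF [c [V [ac oV Vt cV DV]]] [d [W [ad oW Wt dW DW]]].
move=> /nbhs_open[B [oB Bt UB]].
have oVW := openI oV oW.
pose x u := (c (a u), d (b u)).
have Dx k : Dk k ((V `&` W) `&` B) x.
  apply: (@sub_Dk _ _ _ (V `&` W)); first exact: subIsetl.
  apply: (Dk_pair oVW); first exact: sub_Dk (@subIsetl _ _ _) (DV k).
  exact: sub_Dk (@subIsetr _ _ _) (DW k).
have := smooth_into_comp (pair_fbasis (rV_fbasis l) (rV_fbasis m))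
  (sF c d ac ad) (openI oVW oB) (conj (conj Vt Wt) Bt) _ Dx.
move=> H; apply: smooth_at_eq (H _); last first.
  move=> u [[Vu Wu] Bu]; split; [exact/coord_cod/cV|exact/coord_cod/dW|].
  by rewrite /x/= !coordK; [exact: UB|exact: dW|exact: cV].
apply: filterS (open_nbhs_nbhs (conj oVW (conj Vt Wt))) => u [Vu Wu] /=.
by rewrite !coordK//; [exact: dW|exact: cV].
Qed.

Section two_variables.
Context (F : L -> M -> N) (sF : smooth_on2 setT F).

(** The expression of [F] in the charts at p and q. The two partial maps are [phi] composed with
    affine inclusions of the factors, so that the partial differentials come from the total one. *)
Let phi (p : L) (q : M) (x : 'rV[R]_l * 'rV[R]_m) :=
  F (param (chart_at p) x.1) (param (chart_at q) x.2).

Let phiE p q : phi p q (chart_at p p, chart_at q q) = F p q.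
Proof. by rewrite /phi/= !coordK//; exact: chart_at_dom. Qed.

Let phi_continuous p q :
  {for (chart_at p p, chart_at q q), continuous (phi p q)}.
Proof.
have [cF _] := sF (chart_at_atlas p) (chart_at_atlas q).
by apply: cF; split=> //; exact: chart_at_cod.
Qed.

Let phi_diff p q : differentiable (chart_at (F p q) \o phi p q)
  (chart_at p p, chart_at q q).
Proof.
have [_ dF] := sF (chart_at_atlas p) (chart_at_atlas q).
apply: (dF (chart_at (F p q)) (chart_at_atlas _) 1%N).1; split.
  by split=> //; exact: chart_at_cod.
rewrite /= -/(phi p q (chart_at p p, chart_at q q)) phiE.
exact: chart_at_dom.
Qed.

Let pairl_diff (y : 'rV[R]_m) (x : 'rV[R]_l) :
  differentiable (fun z => (z, y) : 'rV[R]_l * 'rV[R]_m) x /\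
  forall v, 'd (fun z => (z, y) : 'rV[R]_l * 'rV[R]_m) x v = (v, 0).
Proof.
have di : differentiable (@idfun 'rV[R]_l) x by exact: ex_diff.
have dc : differentiable (cst y : 'rV[R]_l -> _) x by exact: ex_diff.
split=> [|v]; first exact: (differentiable_pair di dc).
by rewrite (diff_pair di dc) diff_cst diff_val.
Qed.

Let pairr_diff (x : 'rV[R]_l) (y : 'rV[R]_m) :
  differentiable (fun z => (x, z) : 'rV[R]_l * 'rV[R]_m) y /\
  forall v, 'd (fun z => (x, z) : 'rV[R]_l * 'rV[R]_m) y v = (0, v).
Proof.
have di : differentiable (@idfun 'rV[R]_m) y by exact: ex_diff.
have dc : differentiable (cst x : 'rV[R]_m -> _) y by exact: ex_diff.
split=> [|v]; first exact: (differentiable_pair dc di).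
by rewrite (diff_pair dc di) diff_cst diff_val.
Qed.

Let chartl p q : chart_at (F p q) \o F^~ q \o param (chart_at p) =
  (chart_at (F p q) \o phi p q) \o (fun z => (z, chart_at q q)).
Proof.
apply/funext => z; rewrite /= /phi/= [param (chart_at q) _]coordK//.
exact: chart_at_dom.
Qed.

Let chartr p q : chart_at (F p q) \o F p \o param (chart_at q) =
  (chart_at (F p q) \o phi p q) \o (fun z => (chart_at p p, z)).
Proof.
apply/funext => z; rewrite /= /phi/= [param (chart_at p) _]coordK//.
exact: chart_at_dom.
Qed.

Lemma smooth_on2_mdiffl p q : mdiff (F^~ q) p.
Proof.
split; last first.
  rewrite chartl; apply: differentiable_comp; last exact: phi_diff.
  exact: (pairl_diff _ _).1.
have cf : {for p, continuous
    (phi p q \o (fun z => (z, chart_at q q)) \o chart_at p)}.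
  apply: continuous_comp.
    exact/Defs.coord_continuous/chart_at_dom.
  apply: continuous_comp; last exact: phi_continuous.
  exact/differentiable_continuous/(pairl_diff _ _).1.
apply: near_eq_continuous_at cf.
apply: filterS (near_dom_chart_at p) => r dr.
by rewrite /= /phi/= !coordK//; exact: chart_at_dom.
Qed.

Lemma smooth_on2_mdiffr p q : mdiff (F p) q.
Proof.
split; last first.
  rewrite chartr; apply: differentiable_comp; last exact: phi_diff.
  exact: (pairr_diff _ _).1.
have cf : {for q, continuous
    (phi p q \o (fun z => (chart_at p p, z)) \o chart_at q)}.
  apply: continuous_comp.
    exact/Defs.coord_continuous/chart_at_dom.
  apply: continuous_comp; last exact: phi_continuous.
  exact/differentiable_continuous/(pairr_diff _ _).1.
apply: near_eq_continuous_at cf.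
apply: filterS (near_dom_chart_at q) => r dr.
by rewrite /= /phi/= !coordK//; exact: chart_at_dom.
Qed.

Lemma velocity_comp2 (a : R -> L) (b : R -> M) t :
  smooth_at a t -> smooth_at b t ->
  velocity (fun u => F (a u) (b u)) t =
    tangent_map (F^~ (b t)) (a t) (velocity a t) +
    tangent_map (F (a t)) (b t) (velocity b t).
Proof.
move=> sa sb; set p := a t; set q := b t.
have [dx x'] := derivable_pair (smooth_at_derivable_chart_at sa)
  (smooth_at_derivable_chart_at sb).
have [_ H] := is_derive_compd (phi_diff p q) dx.
rewrite /tangent_map chartl chartr.
have [dl ll] := pairl_diff (chart_at q q) (chart_at p p).
have [dr rr] := pairr_diff (chart_at p p) (chart_at q q).
rewrite (diff_comp dl (phi_diff p q)) (diff_comp dr (phi_diff p q)).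
rewrite /= ll rr -linearD /= -[velocity a t]/(derive1 _ t).
rewrite (_ : (velocity a t, 0) + (0, velocity b t) =
   (velocity a t, velocity b t)); last first.
  by rewrite /GRing.add/= /add_pair/= addr0 add0r.
rewrite -[(velocity a t, _)]x' -[RHS]H.
apply: near_derive1.
apply: filterS2 (near_dom sa (chart_at_dom p)) (near_dom sb (chart_at_dom q)).
by move=> u du dv; rewrite /= /phi/= !coordK.
Qed.

End two_variables.

End smooth_maps_along_curves.

(** * Ordinary differential equations *)

Section picard.
Context {R : realType}.

(** The integral starts at a - 1, so that a is interior to the interval of integration; hence the
    radius 1. *)
Lemma continuous_antiderivative (f : R -> R) (a : R) : continuous f ->
  exists F : R -> R, forall t, `|t - a| < 1 ->
    derivable F t 1 /\ derive1 F t = f t.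
Proof.
move=> cf; exists (fun x => \int[lebesgue_measure]_(t in `[a - 1, x]) f t).
move=> t; rewrite ltr_norml => /andP[ta at1].
apply: (@continuous_FTC1_closed _ f (a - 1) t (a + 1)).
- lra.
- apply: continuous_compact_integrable; first exact: segment_compact.
  exact: continuous_subspaceT.
- lra.
- exact: cf.
Qed.

Lemma rV_antiderivative n (f : R -> 'rV[R]_n) (a : R) (y0 : 'rV[R]_n) :
  continuous f -> exists F : R -> 'rV[R]_n, F a = y0 /\
    forall t, `|t - a| < 1 -> derivable F t 1 /\ derive1 F t = f t.
Proof.
move=> cf.
have cfi i : continuous (fun t => f t 0 i).
  move=> t; apply: (@continuous_comp _ _ _ f (fun y : 'rV_n => y 0 i)).
    exact: cf.
  exact: coord_continuous.
have /choice[F FP] := fun i => continuous_antiderivative a (cfi i).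
exists (fun t => \row_i (F i t - F i a + y0 0 i)); split.
  by apply/rowP => i; rewrite mxE subrr add0r.
move=> t ta.
have dF i j : derivable (fun u => (\row_i (F i u - F i a + y0 0 i)) i j : R) t 1.
  under eq_fun do rewrite mxE -addrA.
  by apply: derivableD; [exact: (FP j t ta).1|exact: derivable_cst].
have dM : derivable (fun u => \row_i (F i u - F i a + y0 0 i)) t 1.
  exact/derivable_mxP.
split=> //; apply/rowP => i; rewrite derive1_mx//.
under eq_fun do rewrite mxE -addrA.
have [dFi <-] := FP i t ta.
rewrite !derive1E; apply: etrans (deriveD dFi (derivable_cst _ _ _)) _.
by rewrite derive_cst addr0.
Qed.

(** The passage to the limit in the Picard estimates, from the Archimedean property and N <= 2^N. *)
Lemma half_pow_le (x y c : R) :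
  (forall n, x <= y + c * 2^-1 ^+ n) -> x <= y.
Proof.
move=> H; rewrite leNgt; apply/negP => yx.
have c0 : 0 < c by have := H 0%N; rewrite expr0 mulr1; lra.
have d0 : 0 < x - y by rewrite subr_gt0.
pose N := Num.bound (c / (x - y)).
have cN : c / (x - y) < N%:R by apply: archi_boundP; rewrite divr_ge0// ltW.
have cN2 : c / (x - y) < 2 ^+ N.
  by rewrite (lt_le_trans cN)// -natrX ler_nat ltnW// ltn_expl.
have := H N; rewrite exprVn -lerBlDl leNgt => /negP; apply.
by rewrite ltr_pdivrMr ?exprn_gt0// mulrC -ltr_pdivrMr.
Qed.

(** With e n = 2c / 2^n one has e (n + 1) + c / 2^n = e n, so the intervals of radius e n around u n
    are nested; the supremum of their left ends lies in all of them, which gives the rate at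
    once. *)
Lemma geometric_limit (u : nat -> R) (c : R) : 0 <= c ->
  (forall n, `|u n.+1 - u n| <= c * 2^-1 ^+ n) ->
  exists l, forall n, `|u n - l| <= 2 * c * 2^-1 ^+ n.
Proof.
move=> c0 uc.
pose e n := 2 * c * 2^-1 ^+ n : R.
have eS n : e n.+1 + c * 2^-1 ^+ n = e n.
  by rewrite /e exprS; set z := _ ^+ n; lra.
have e0 n : 0 <= e n by rewrite !mulr_ge0// exprn_ge0// invr_ge0.
have lo : {homo (fun n => u n - e n) : m n / (m <= n)%N >-> m <= n}.
  apply: homo_leq => [x|x y z|n]; [exact: lexx|exact: le_trans|].
  by have := uc n; have := eS n; rewrite ler_norml => ? /andP[? ?]; lra.
have hi : {homo (fun n => u n + e n) : m n / (m <= n)%N >-> n <= m}.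
  apply: homo_leq => [x|x y z /[swap]|n]; [exact: lexx|exact: le_trans|].
  by have := uc n; have := eS n; rewrite ler_norml => ? /andP[? ?]; lra.
have lohi m n : u m - e m <= u n + e n.
  have := lo _ _ (leq_maxl m n); have := hi _ _ (leq_maxr m n).
  by have := e0 (maxn m n); lra.
pose S := range (fun n => u n - e n).
have S0 : S !=set0 by exists (u 0%N - e 0%N); exists 0%N.
have ubS n : ubound S (u n + e n) by move=> _ [m _ <-].
exists (sup S) => n; rewrite -/(e n).
have h1 : u n - e n <= sup S.
  by apply: ub_le_sup; [exists (u 0%N + e 0%N)|exists n].
have h2 : sup S <= u n + e n by exact: ge_sup.
by rewrite ler_norml; apply/andP; split; lra.
Qed.

Lemma lipschitz_continuous (E F : normedModType R) (f : E -> F) (K : R) :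
  (forall x y, `|f x - f y| <= K * `|x - y|) -> continuous f.
Proof.
move=> fK x; apply/cvgrPdist_le => e e0.
have K1 : 0 < `|K| + 1 by rewrite ltr_wpDl.
near=> y; rewrite (le_trans (fK _ _))//.
rewrite (@le_trans _ _ ((`|K| + 1) * `|x - y|))//.
  by rewrite ler_wpM2r// ler_wpDr// ler_norm.
rewrite -ler_pdivlMl//; near: y.
by apply: cvgr_dist_le; [exact: cvg_id|rewrite mulr_gt0// invr_gt0].
Unshelve. all: by end_near. Qed.

Definition clamp (c e t : R) : R := Num.max (c - e) (Num.min (c + e) t).

Lemma clamp_dist c e t : 0 <= e -> `|clamp c e t - c| <= e.
Proof.
move=> e0; rewrite ler_norml /clamp.
by case: (leP (c + e) t) => h1; case: (leP (c - e) _) => h2; apply/andP;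
  split; lra.
Qed.

Lemma clamp_id c e t : `|t - c| <= e -> clamp c e t = t.
Proof.
rewrite ler_norml => /andP[h1 h2]; rewrite /clamp min_r; last lra.
by rewrite max_r//; lra.
Qed.

Lemma clamp_lipschitz c e s t : `|clamp c e s - clamp c e t| <= `|s - t|.
Proof.
wlog st : s t / s <= t.
  by move=> H; case: (leP s t) => [/H//|/ltW/H]; rewrite distrC (distrC t).
have ce : clamp c e s <= clamp c e t.
  by apply: le_max2; rewrite ?lexx// le_min2.
rewrite distrC (distrC s) !ger0_norm ?subr_ge0//.
move: ce; rewrite /clamp.
case: (leP (c + e) s) => h1.
  case: (leP (c + e) t) => h2; last lra.
  by rewrite subrr subr_ge0.
case: (leP (c + e) t) => h2; case: (leP (c - e) s) => h3.
- by case: (leP (c - e) (c + e)) => h4; lra.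
- by case: (leP (c - e) (c + e)) => h4; lra.
- by case: (leP (c - e) t) => h4; lra.
- by case: (leP (c - e) t) => h4; lra.
Qed.

Section fixed_point.
Context {n : nat} (f : R -> 'rV[R]_n -> 'rV[R]_n) (a : R) (y0 : 'rV[R]_n)
  (K L : R).
Hypothesis L0 : 0 < L.
Hypothesis fc : forall y : R -> 'rV[R]_n, continuous y ->
  continuous (fun t => f t (y t)).
Hypothesis fK : forall t y, `|f t y| <= K.
Hypothesis fL : forall t y z, `|f t y - f t z| <= L * `|y - z|.

(** The operator sends w to the antiderivative of [f t (w t)] with value [y0] at a. That
    antiderivative is controlled near a only; precomposed with the clamping of time to
    [a - d, a + d] it is K-Lipschitz on the whole line, so the iteration stays among continuous
    functions on R and converges uniformly. *)
Lemma picard : exists d (y : R -> 'rV[R]_n), [/\ 0 < d, y a = y0 &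
  forall t, `|t - a| < d -> derivable y t 1 /\ derive1 y t = f t (y t)].
Proof.
have K0 : 0 <= K by exact: le_trans (fK a y0).
(* d < 1 stays within the radius of control of the antiderivatives, and L d <= 1/2 makes the
   iteration a contraction of ratio 1/2. *)
pose d := Num.min 2^-1 (2 * L)^-1.
have d0 : 0 < d by rewrite lt_min !invr_gt0 mulr_gt0 ?andbT.
have d1 : d < 1 by rewrite gt_min; apply/orP; left; lra.
have dL : L * d <= 2^-1.
  rewrite (@le_trans _ _ (L * (2 * L)^-1))//.
    by rewrite ler_wpM2l ?(ltW L0)// ge_min lexx orbT.
  by rewrite invfM mulrCA divff ?mulr1// gt_eqF.
pose k := clamp a d.
have kd t : `|k t - a| <= d by apply: clamp_dist; exact: ltW.
have kid t : `|t - a| <= d -> k t = t by exact: clamp_id.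
have ka : k a = a by rewrite kid// subrr normr0 ltW.
have btw s t u : `|s - a| <= d -> `|t - a| <= d ->
    Num.min s t <= u <= Num.max s t -> `|u - a| < 1.
  rewrite !ler_norml ltr_norml => /andP[? ?] /andP[? ?].
  by case: (leP s t) => _ /andP[? ?]; apply/andP; split; lra.
(* The operator is chosen on all functions; on discontinuous ones its value is the default 0. *)
have /choice[T TP] : forall w : R -> 'rV[R]_n, exists F : R -> 'rV[R]_n,
    continuous w -> F a = y0 /\ forall t, `|t - a| < 1 ->
      derivable F t 1 /\ derive1 F t = f t (w t).
  move=> w; have [cw|ncw] := pselect (continuous w); last by exists (cst 0).
  by have [F FP] := rV_antiderivative a y0 (fc cw); exists F.
pose S w := T w \o k.
have SK (w : R -> 'rV[R]_n) : continuous w -> forall s t, `|S w s - S w t| <= K * `|s - t|.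
  move=> /TP[_ dT] s t; rewrite (@le_trans _ _ (K * `|k s - k t|))//.
    apply: (rV_mvt_lipschitz (f := T w)) => // u /btw us.
    by have [? ->] := dT u (us (kd t) (kd s)).
  by rewrite ler_wpM2l// clamp_lipschitz.
have Sc (w : R -> 'rV[R]_n) : continuous w -> continuous (S w).
  by move=> /SK SwK; exact: lipschitz_continuous SwK.
have contr (w w' : R -> 'rV[R]_n) C : continuous w -> continuous w' ->
    (forall t, `|w t - w' t| <= C) -> forall t, `|S w t - S w' t| <= C / 2.
  move=> cw cw' C_ t; have [Ta dT] := TP _ cw; have [Ta' dT'] := TP _ cw'.
  have C0 : 0 <= C by exact: le_trans (C_ a).
  have LC : 0 <= L * C by rewrite mulr_ge0// ltW.
  pose g u := T w u - T w' u.
  have ga : g a = 0 by rewrite /g Ta Ta' subrr.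
  rewrite -[_ - _]/(g (k t)) -[g _]subr0 -ga.
  rewrite (@le_trans _ _ (L * C * `|k t - a|))//.
    apply: (rV_mvt_lipschitz (f := g)) => // u.
    rewrite minC maxC => /btw; rewrite subrr normr0 => /(_ (kd t) (ltW d0)) ua.
    have [du du'] := dT u ua; have [dv dv'] := dT' u ua.
    split; first exact: derivableB.
    have -> : derive1 g u = f u (w u) - f u (w' u).
      by rewrite -du' -dv'; exact: derive1B.
    by rewrite (le_trans (fL _ _ _))// ler_wpM2l// ltW.
  rewrite (@le_trans _ _ (L * C * d))// ?ler_wpM2l//.
  by rewrite mulrAC mulrC ler_wpM2l.
pose w i := iter i S (cst y0).
have wc i : continuous (w i).
  elim: i => [|i IH]; last exact: Sc.
  by move=> x; exact: cvg_cst.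
pose C := K * d.
have C0 : 0 <= C by rewrite mulr_ge0// ltW.
have wS i t : `|w i.+1 t - w i t| <= C * 2^-1 ^+ i.
  elim: i t => [|i IH] t.
    rewrite expr0 mulr1 -[w 0%N t]/y0 -[y0](TP _ (wc 0%N)).1.
    rewrite -[w 1%N t]/(T (w 0%N) (k t)) (@le_trans _ _ (K * `|k t - a|))// ?ler_wpM2l//.
    apply: (rV_mvt_lipschitz (f := T (w 0%N))) => // u.
    rewrite minC maxC => /btw; rewrite subrr normr0 => /(_ (kd t) (ltW d0)) ua.
    by have [? ->] := (TP _ (wc 0%N)).2 u ua.
  rewrite exprSr mulrA; exact: (contr _ _ _ (wc i.+1) (wc i) IH t).
have /choice[v vP] : forall t, exists l : 'rV[R]_n,
    forall i, `|w i t - l| <= 2 * C * 2^-1 ^+ i.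
  move=> t; have /choice[l lP] : forall j, exists l, forall i,
      `|w i t 0 j - l| <= 2 * C * 2^-1 ^+ i.
    move=> j; apply: geometric_limit => // i.
    by have := rV_norm_coord j (w i.+1 t - w i t); rewrite !mxE => /le_trans; exact.
  exists (\row_j l j) => i; apply: rV_norm_le => [|j].
    by rewrite mulr_ge0 ?exprn_ge0 ?invr_ge0// mulr_ge0.
  by rewrite !mxE; exact: lP.
have vK s t : `|v s - v t| <= K * `|s - t|.
  apply: (@half_pow_le _ _ (2 * C)) => i.
  have h1 := vP s i.+1; have h2 := vP t i.+1.
  have h3 := SK _ (wc i) s t; rewrite -[S (w i)]/(w i.+1) in h3.
  (* Each of the two errors at stage i + 1 is at most C / 2^i; together they give the constant
     2C. *)
  have -> : v s - v t = (w i.+1 s - w i.+1 t) + (w i.+1 t - v t) -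
      (w i.+1 s - v s).
    rewrite addrACA [X in _ = X]addrC; apply/rowP => j; rewrite !mxE; lra.
  rewrite (le_trans (ler_normB _ _))//.
  have := ler_normD (w i.+1 s - w i.+1 t) (w i.+1 t - v t).
  by move: h1 h2 h3; rewrite !exprS; set p := 2^-1 ^+ i; lra.
have vc : continuous v by exact: lipschitz_continuous vK.
have vS t : v t = S v t.
  apply/eqP; rewrite -subr_eq0 -normr_le0; apply: (@half_pow_le _ _ (2 * C)) => i.
  rewrite add0r.
  have h1 := vP t i.+1; have h2 := contr _ _ _ (wc i) vc (fun t => vP t i) t.
  rewrite -[S (w i)]/(w i.+1) in h2.
  have -> : v t - S v t = (w i.+1 t - S v t) - (w i.+1 t - v t).
    by apply/rowP => j; rewrite !mxE; lra.
  rewrite (le_trans (ler_normB _ _))//.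
  by move: h1 h2; rewrite !exprS; set p := 2^-1 ^+ i; lra.
have [Ta dT] := TP _ vc.
(* [v] and [T v] agree on [a - d, a + d], and the derivative of [T v] is known by construction. *)
exists d, (T v); split=> // t td.
by have [|? ->] := dT t; rewrite ?(lt_trans td)// vS /S/= kid ?ltW.
Qed.

End fixed_point.

End picard.

(** * Local Lipschitz bounds and local solvability *)

Section ode.
Context {R : realType}.

Lemma continuous_near_bound (E : topologicalType) (F : normedModType R)
    (f : E -> F) (x : E) : {for x, continuous f} ->
  \forall y \near x, `|f y| <= `|f x| + 1.
Proof.
move=> cf; have cn : {for x, continuous (fun y => `|f y|)}.
  by apply: continuous_comp => //; exact: norm_continuous.
by apply: (cvgr_le _ cn); rewrite ltrDl.
Qed.

(** By continuity the derivatives along the basis stay bounded on a ball around x. Balls are convex,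
    so the mean value inequality applies on the segment from z to y. *)
Lemma C1_locally_lipschitz (E : normedModType R) (b : fbasis E) n
    (g : E -> 'rV[R]_n) (V : set E) (x : E) : nbhs x V -> Ck 1 V g ->
  exists r K : R, [/\ 0 < r, 0 < K & forall y z, `|y - x| < r -> `|z - x| < r ->
    `|g y - g z| <= K * `|y - z|].
Proof.
move=> Vx [dg cDg]; have Vxx := nbhs_singleton Vx.
pose B i := `|'D_(@bvec _ _ b i) g x| + 1.
have B0 i : 0 <= B i by rewrite addr_ge0.
have nB : \forall y \near x, forall i, `|'D_(@bvec _ _ b i) g y| <= B i.
  by apply: filter_forall => i; apply: continuous_near_bound; exact: cDg.
have : nbhs x [set y | V y /\ forall i, `|'D_(@bvec _ _ b i) g y| <= B i].
  exact: filterI.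
move=> /nbhs_ballP[r /= r0 rB].
pose K := \sum_i B i + 1.
have K0 : 0 < K by rewrite ltr_wpDl// sumr_ge0.
exists r, K; split=> // y z yr zr.
pose h (u : R) := z + u *: (y - z).
have hr u : 0 <= u <= 1 -> ball x r (h u).
  move=> /andP[u0 u1]; rewrite -ball_normE/= distrC.
  have -> : h u - x = u *: (y - x) + (1 - u) *: (z - x).
    rewrite scalerBl scale1r addrCA -scalerBr opprB addrA subrK.
    by rewrite /h addrAC.
  rewrite (le_lt_trans (ler_normD _ _))// !normrZ (ger0_norm u0).
  rewrite (ger0_norm (_ : 0 <= 1 - u)) ?subr_ge0//.
  (* The strict inequality comes from the term with factor u, hence the separate case u = 0. *)
  have [->|u00] := eqVneq u 0; first by rewrite mul0r add0r subr0 mul1r.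
  rewrite -[ltRHS](_ : u * r + (1 - u) * r = r); last by ring.
  apply: ltr_leD; first by rewrite ltr_pM2l// lt_def u00.
  by apply: ler_wpM2l; rewrite ?subr_ge0// ltW.
have dh u : derivable h u 1 /\ derive1 h u = y - z.
  by split; [exact: derivable_line|exact: derive1_line].
have -> : g y - g z = (g \o h) 1 - (g \o h) 0.
  by rewrite /h/= scale1r scale0r addr0 [z + _]addrC subrK.
rewrite -[leRHS]mulr1 -[X in _ * X](subr0 1) -[X in _ * X](ger0_norm); last first.
  by rewrite subr0.
apply: rV_mvt_lipschitz; first by rewrite mulr_ge0// ltW.
move=> u; rewrite min_l// max_r// => u01.
have [Vu Bu] := rB _ (hr u u01); have [du h'] := dh u.
have [dgh ->] := is_derive_compd (dg _ Vu) du.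
split=> //; rewrite h' (diff_basis b)//; last exact: dg.
rewrite (le_trans (ler_norm_sum _ _ _))// /K mulrDl ler_wpDr ?mul1r//.
rewrite mulr_suml; apply: ler_sum => i _.
by rewrite normrZ mulrC ler_pM ?bcoord_le.
Qed.

(** Coordinatewise clamping is 1-Lipschitz and lands within r of [y0], because the norm is the sup
    norm. *)
Definition rV_clamp n (y0 : 'rV[R]_n) (r : R) (y : 'rV[R]_n) : 'rV[R]_n :=
  \row_i clamp (y0 0 i) r (y 0 i).

Lemma rV_clamp_dist n (y0 : 'rV[R]_n) r y : 0 <= r ->
  `|rV_clamp y0 r y - y0| <= r.
Proof.
by move=> r0; apply: rV_norm_le => // i; rewrite !mxE; exact: clamp_dist.
Qed.

Lemma rV_clamp_id n (y0 : 'rV[R]_n) r y : `|y - y0| <= r ->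
  rV_clamp y0 r y = y.
Proof.
move=> yr; apply/rowP => i; rewrite mxE clamp_id//.
by have := rV_norm_coord i (y - y0); rewrite !mxE => /le_trans; exact.
Qed.

Lemma rV_clamp_lipschitz n (y0 : 'rV[R]_n) r y z :
  `|rV_clamp y0 r y - rV_clamp y0 r z| <= `|y - z|.
Proof.
apply: rV_norm_le => // i; rewrite !mxE (le_trans (clamp_lipschitz _ _ _ _))//.
by have := rV_norm_coord i (y - z); rewrite !mxE.
Qed.

(* Clamping time and space makes the right-hand side globally Lipschitz without
   changing the equation near the initial condition. *)
Lemma affine_ode n (I : finType) (X : I -> R -> R)
    (b : I -> 'rV[R]_n -> 'rV[R]_n) (a : R) (y0 : 'rV[R]_n) :
  (forall i, \forall t \near a, {for t, continuous (X i)}) ->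
  (forall i, exists r K, 0 < r /\ forall y z, `|y - y0| < r -> `|z - y0| < r ->
     `|b i y - b i z| <= K * `|y - z|) ->
  exists y : R -> 'rV[R]_n, y a = y0 /\ \forall t \near a,
    derivable y t 1 /\ derive1 y t = \sum_i X i t *: b i (y t).
Proof.
move=> cX /choice[ri /choice[Ki bKi]].
(* The default 1 covers an empty family; absolute values are summed because nothing is known about
   the signs of the constants. *)
pose r := \big[Num.min/1]_i ri i; pose K := \sum_i `|Ki i|.
have r0 : 0 < r by apply/bigmin_gtP; split=> // i _; exact: (bKi i).1.
have bK i y z : `|y - y0| < r -> `|z - y0| < r ->
    `|b i y - b i z| <= K * `|y - z|.
  have rri : r <= ri i by exact: bigmin_le_cond.
  move=> /lt_le_trans/(_ rri) yr /lt_le_trans/(_ rri) zr.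
  rewrite (le_trans ((bKi i).2 y z yr zr))// ler_wpM2r// /K (bigD1 i)//=.
  by rewrite ler_wpDr ?sumr_ge0// ler_norm.
have K0 : 0 <= `|K| by [].
have nX : \forall t \near a, forall i, {for t, continuous (X i)} /\
    `|X i t| <= `|X i a| + 1.
  have := @filter_forall _ I (fun i t => {for t, continuous (X i)} /\
    `|X i t| <= `|X i a| + 1) (nbhs a) _.
  apply => i; apply: filterI; first exact: cX.
  exact: continuous_near_bound (nbhs_singleton (cX i)).
move: nX => /nbhs_ballP[e0 /= e00 eX].
(* Clamping lands in a closed ball, which halving the radius puts inside the open ball where the
   bounds hold; likewise for s below. *)
pose e := e0 / 2; have e_gt0 : 0 < e by rewrite divr_gt0.
have ee0 : e < e0 by rewrite /e; lra.
pose s := r / 2; have s0 : 0 < s by rewrite divr_gt0.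
have sr : s < r by rewrite /s; lra.
pose Xc i t := X i (clamp a e t).
pose bc i y := b i (rV_clamp y0 s y).
have ce t : ball a e0 (clamp a e t).
  by rewrite -ball_normE/= distrC (le_lt_trans _ ee0)// clamp_dist// ltW.
have cXc i : continuous (Xc i).
  move=> t; apply: (@continuous_comp _ _ _ (clamp a e) (X i)).
    apply: (@lipschitz_continuous _ _ _ _ 1) => x y.
    by rewrite mul1r clamp_lipschitz.
  exact: (eX _ (ce t) i).1.
have bXc i t : `|Xc i t| <= `|X i a| + 1 := (eX _ (ce t) i).2.
have cs y : `|rV_clamp y0 s y - y0| < r.
  by rewrite (le_lt_trans _ sr)// rV_clamp_dist// ltW.
have bcL i y z : `|bc i y - bc i z| <= `|K| * `|y - z|.
  rewrite (le_trans (bK i _ _ (cs y) (cs z)))//.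
  rewrite (le_trans (ler_wpM2r _ (ler_norm K)))//.
  by rewrite ler_wpM2l// rV_clamp_lipschitz.
have bcB i y : `|bc i y| <= `|b i y0| + `|K| * r.
  rewrite -[bc i y](subrK (b i y0)) addrC (le_trans (ler_normD _ _))// lerD2l.
  rewrite (le_trans (bK i _ _ (cs y) _)) ?subrr ?normr0//.
  by rewrite (le_trans (ler_wpM2r _ (ler_norm K)))// ler_wpM2l// ltW.
pose f t y := \sum_i Xc i t *: bc i y.
(* The summand 1 keeps L positive even when the sum is zero. *)
pose L := \sum_i (`|X i a| + 1) * `|K| + 1.
have L0 : 0 < L by rewrite ltr_wpDl// sumr_ge0// => i _; rewrite mulr_ge0.
have [|||d [y [d0 ya dy]]] := @picard R n f a y0
  (\sum_i (`|X i a| + 1) * (`|b i y0| + `|K| * r)) L L0.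
- move=> y cy t; rewrite /f; apply: cvg_big => [|i _]; first exact: add_continuous.
  apply: cvgZ; first exact: cXc.
  apply: (@continuous_comp _ _ _ y (bc i)); first exact: cy.
  exact: (lipschitz_continuous (bcL i)).
- move=> t y; rewrite (le_trans (ler_norm_sum _ _ _))// ler_sum// => i _.
  by rewrite normrZ ler_pM.
- move=> t y z; rewrite /f -sumrB (le_trans (ler_norm_sum _ _ _))//.
  rewrite /L mulrDl ler_wpDr ?mul1r// mulr_suml ler_sum// => i _.
  by rewrite -scalerBr normrZ -mulrA ler_pM.
exists y; split=> //.
have cy : {for a, continuous y}.
  apply/differentiable_continuous/derivable1_diffP.
  by have [] := dy a; rewrite ?subrr ?normr0.
have na (c : R) : 0 < c -> \forall t \near a, `|t - a| < c.
  move=> c0; apply: filterS (nbhsx_ballx a c c0) => t.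
  by rewrite -ball_normE/= distrC.
have ns : \forall t \near a, `|y t - y0| <= s.
  by move/cvgrPdistC_le: cy => /(_ s s0); rewrite ya.
apply: filterS3 (na d d0) (na e e_gt0) ns => t td /ltW te ts.
have [dyt ->] := dy t td.
by split=> //; apply: eq_bigr => i _; rewrite /Xc /bc clamp_id// rV_clamp_id.
Qed.

End ode.

(** * Horizontal curves *)

Section lie_group_curves.
Context {R : realType} {k : nat} {G : lieGroupType R k}.

Lemma mdiff_mulgl (g h : G) : mdiff (fun x : G => x * g)%g h.
Proof. exact: (smooth_on2_mdiffl mulg_smooth). Qed.

Lemma mdiff_mulgr (g h : G) : mdiff (fun x : G => g * x)%g h.
Proof. exact: (smooth_on2_mdiffr mulg_smooth). Qed.

Lemma smooth_at_mulg (a b : R -> G) t : smooth_at a t -> smooth_at b t ->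
  smooth_at (fun u => a u * b u)%g t.
Proof.
move=> sa sb; apply: (smooth_at_comp2 mulg_smooth sa sb).
by apply: filterE.
Qed.

Lemma smooth_at_invg (a : R -> G) t : smooth_at a t ->
  smooth_at (fun u => (a u)^-1)%g t.
Proof.
by move=> sa; apply: (smooth_at_comp invg_smooth sa); apply: filterE.
Qed.

Lemma velocity_mulgr (g : G) (a : R -> G) t : smooth_at a t ->
  velocity (fun u => g * a u)%g t =
    tangent_map (fun x : G => g * x)%g (a t) (velocity a t).
Proof. by move=> sa; apply: velocity_comp => //; exact: mdiff_mulgr. Qed.

(** Evaluates [Ad], defined through charts, on curves through 1, so that identities between group
    elements can be differentiated. *)
Lemma Ad_velocity (g : G) (a : R -> G) t : smooth_at a t -> a t = 1%g ->
  velocity (fun u => g * a u * g^-1)%g t = Ad g (velocity a t).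
Proof.
move=> sa at1; rewrite /Ad -[X in tangent_map _ X]at1.
apply: (velocity_comp (F := fun h : G => (g * h * g^-1)%g)) => //.
exact: (mdiff_comp (mdiff_mulgr _ _) (mdiff_mulgl _ _)).
Qed.

Lemma Ad0 (g : G) : Ad g 0 = 0.
Proof. exact: linear0. Qed.

Lemma AdN (g : G) v : Ad g (- v) = - Ad g v.
Proof. exact: linearN. Qed.

End lie_group_curves.

Lemma near_near (T : topologicalType) (x : T) (S : T -> Prop) :
  (\forall y \near x, S y) -> \forall y \near x, \forall z \near y, S z.
Proof.
move=> /nbhs_open[B [oB Bx BS]].
apply: filterS (open_nbhs_nbhs (conj oB Bx)) => y By.
by apply: filterS (open_nbhs_nbhs (conj oB By)).
Qed.

(** * Induction along an interval *)

Section interval_induction.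
Context {R : realType}.

(** A compactness argument shared by uniqueness and existence of lifts: local validity around the
    supremum of the points reached from a joins a reached point to one beyond it. *)
Lemma interval_induction (Q : R -> R -> Prop) :
  (forall t, exists2 e, 0 < e & forall a b, t - e < a -> a <= b -> b < t + e ->
     Q a b) ->
  (forall a b c, a <= b -> b <= c -> Q a b -> Q b c -> Q a c) ->
  forall a b, a <= b -> Q a b.
Proof.
move=> loc tr a b ab.
pose S := [set x | a <= x <= b /\ Q a x].
have Sa : S a.
  have [e e0 eQ] := loc a; split; first by rewrite lexx.
  by apply: eQ; rewrite ?lexx// ?ltrDl// ltrBlDr ltrDl.
have ubS : has_ubound S by exists b => x [/andP[]].
have supS : has_sup S by split; [exists a|].
have as_ : a <= sup S by exact: ub_le_sup.
have sb : sup S <= b by apply: ge_sup; [exists a|move=> x [/andP[]]].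
have [e e0 eQ] := loc (sup S).
have [x [/andP[ax xb] Qx] sx] := sup_adherent e0 supS.
have xs : x <= sup S by apply: ub_le_sup => //; split=> //; exact/andP.
have Qz z : x <= z -> z < sup S + e -> Q a z.
  by move=> xz zs; apply: tr Qx _ => //; exact: eQ.
have [bs|sb'] := leP b (sup S).
  by apply: Qz => //; rewrite (le_lt_trans bs)// ltrDl.
(* Half of e keeps z strictly inside the interval of local validity, and the minimum keeps it in
   [a, b]. *)
pose z := Num.min b (sup S + e / 2).
have sz : sup S < z by rewrite lt_min sb'/= ltrDl divr_gt0.
have : z <= sup S.
  apply: ub_le_sup => //; split.
    by rewrite (le_trans as_ (ltW sz))/= ge_min lexx.
  apply: Qz; first by rewrite (le_trans xs)// ltW.
  by rewrite gt_min; apply/orP; right; lra.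
by rewrite leNgt sz.
Qed.

Lemma near_itv (t : R) (S : R -> Prop) : (\forall u \near t, S u) ->
  exists2 e, 0 < e & forall u, t - e < u < t + e -> S u.
Proof.
move=> /nbhs_ballP[e /= e0 eS]; exists e => // u ue; apply: eS.
by rewrite ball_itv/= in_itv.
Qed.

End interval_induction.

(** * The structure group along fibres, and uniqueness of lifts *)

Section bundle.
Context {R : realType} {m n k : nat}.
Context {M : manifoldType R m} {P : manifoldType R n} {G : lieGroupType R k}.
Context (pi : P -> M) (act : P -> G -> P).
Hypothesis bundle : principal_bundle pi act.

Lemma fiber_transitive p q : pi p = pi q -> exists g, q = act p g.
Proof.
move=> pq; have [U [tau [sigma [_ Up [_ _ st _ ta]]]]] := pb_trivial bundle (pi p).
exists ((tau p)^-1 * tau q)%g.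
rewrite -[LHS]st -?pq// -[RHS]st (pb_pi_act bundle)//.
by rewrite ta// mulVKg.
Qed.

Lemma act_inj p g h : act p g = act p h -> g = h.
Proof.
move=> pgh; have [U [tau [sigma [_ Up [_ _ _ _ ta]]]]] := pb_trivial bundle (pi p).
by apply: (mulgI (tau p)); rewrite -!ta// pgh.
Qed.

Lemma act_fixed p g : act p g = p -> g = 1%g.
Proof. by rewrite -{2}[p](pb_act1 bundle) => /act_inj. Qed.

Lemma smooth_at_act (c : R -> P) (g : R -> G) t : smooth_at c t ->
  smooth_at g t -> smooth_at (fun u => act (c u) (g u)) t.
Proof.
move=> sc sg; apply: (smooth_at_comp2 (pb_act_smooth bundle) sc sg).
by apply: filterE.
Qed.

Lemma smooth_at_pi (c : R -> P) t : smooth_at c t -> smooth_at (pi \o c) t.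
Proof.
by move=> sc; apply: (smooth_at_comp (pb_smooth bundle) sc); apply: filterE.
Qed.

(** Near t both curves lie over one trivializing set, where [g] is the quotient of their group
    components. *)
Lemma same_projection_act (c1 c2 : R -> P) t : smooth_at c1 t ->
  smooth_at c2 t -> (\forall u \near t, pi (c1 u) = pi (c2 u)) ->
  exists2 g : R -> G, smooth_at g t & \forall u \near t, c2 u = act (c1 u) (g u).
Proof.
move=> s1 s2 pi12.
have [U [tau [sigma [oU Ut [sT _ st _ ta]]]]] := pb_trivial bundle (pi (c1 t)).
have U1 : \forall u \near t, U (pi (c1 u)).
  apply: (smooth_at_continuous (smooth_at_pi s1)).
  exact: open_nbhs_nbhs.
have U2 : \forall u \near t, U (pi (c2 u)).
  by apply: filterS2 U1 pi12 => u + <-.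
exists (fun u => (tau (c1 u))^-1 * tau (c2 u))%g.
  apply: smooth_at_mulg; last exact: smooth_at_comp sT s2 U2.
  by apply: smooth_at_invg; exact: smooth_at_comp sT s1 U1.
apply: filterS3 U1 U2 pi12 => u u1 u2 u12.
by rewrite -[LHS]st// -[RHS]st (pb_pi_act bundle)// ta// u12 mulVKg.
Qed.

Context (A : P -> {linear 'rV[R]_n -> 'rV[R]_k}).
Hypothesis conn : connection_form act A.

(* In the usual notation, A((c g)') = Ad(g^-1) A(c') + g^-1 g'. *)
Lemma connection_act (c : R -> P) (g : R -> G) t :
  smooth_at c t -> smooth_at g t ->
  A (act (c t) (g t)) (velocity (fun u => act (c u) (g u)) t) =
    Ad ((g t)^-1)%g (A (c t) (velocity c t)) +
    velocity (fun u => (g t)^-1 * g u)%g t.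
Proof.
move=> sc sg; rewrite (velocity_comp2 (pb_act_smooth bundle) sc sg).
rewrite linearD (cf_equivariant conn); congr (_ + _).
set q := act (c t) (g t).
have sg' : smooth_at (fun u => (g t)^-1 * g u)%g t.
  by apply: smooth_at_mulg => //; exact: smooth_at_cst.
rewrite -(velocity_comp (smooth_on2_mdiffr (pb_act_smooth bundle) _ _) sg).
(* Moving the base point to q makes the group curve pass through 1, so its image has a fundamental
   vector as velocity. *)
have -> : act (c t) \o g = act q \o (fun u => (g t)^-1 * g u)%g.
  by apply/funext => u; rewrite /= -(pb_actM bundle) mulVKg.
rewrite (velocity_comp (smooth_on2_mdiffr (pb_act_smooth bundle) _ _) sg').
by rewrite mulVg -[X in A q X]/(fundamental_vector act _ q) (cf_vertical conn).
Qed.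

(** The last two conditions concern t alone; a lift around t is expressed by requiring this at all
    nearby times. *)
Definition hlift_at (gamma : R -> M) (c : R -> P) (t : R) : Prop :=
  [/\ smooth_at c t, A (c t) (velocity c t) = 0 & pi (c t) = gamma t].

Lemma hlift_at_eq gamma c d (t : R) : (\forall u \near t, c u = d u) ->
  hlift_at gamma c t -> hlift_at gamma d t.
Proof.
move=> cd [sc Ac pc]; rewrite /hlift_at -(velocity_eq cd) -(nbhs_singleton cd).
by split=> //; exact: smooth_at_eq cd sc.
Qed.

Lemma hlift_at_act gamma c t g : hlift_at gamma c t ->
  hlift_at gamma (fun u => act (c u) g) t.
Proof.
move=> [sc Ac pc]; have sg := smooth_at_cst g t.
split; first exact: (smooth_at_act sc sg).
  by rewrite (connection_act sc sg) Ac Ad0 add0r; exact: velocity_cst.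
by rewrite (pb_pi_act bundle).
Qed.

Lemma hlift_near_unique gamma c1 c2 (t : R) :
  (\forall u \near t, hlift_at gamma c1 u) ->
  (\forall u \near t, hlift_at gamma c2 u) ->
  exists g, \forall u \near t, c2 u = act (c1 u) g.
Proof.
move=> l1 l2.
have [s1 _ _] := nbhs_singleton l1; have [s2 _ _] := nbhs_singleton l2.
have pi12 : \forall u \near t, pi (c1 u) = pi (c2 u).
  by apply: filterS2 l1 l2 => u [_ _ ->] [_ _ ->].
have [g sg c12] := same_projection_act s1 s2 pi12.
exists (g t); suff gt : \forall u \near t, g u = g t.
  by apply: filterS2 gt c12 => u <-.
apply: velocity0_cst.
apply: filterS2 (filterI l1 l2) (filterI (smooth_at_near sg) (near_near c12)).
move=> u [[s1u A1u _] [s2u A2u _]] [sgu c12u]; split=> //.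
have := connection_act s1u sgu.
rewrite -(velocity_eq c12u) -(nbhs_singleton c12u) A1u A2u Ad0 add0r => v0.
have sg' : smooth_at (fun v => (g u)^-1 * g v)%g u.
  by apply: smooth_at_mulg => //; exact: smooth_at_cst.
(* So far only the left translate of [g] that passes through 1 at u is known to have zero velocity;
   translating by [g u] brings this back to [g]. *)
have := velocity_mulgr (g u) sg'; rewrite -v0 [RHS]linear0 => <-.
by apply: velocity_eq; apply: filterE => v; rewrite mulVKg.
Qed.

Lemma hlift_near_eq gamma c1 c2 (t : R) :
  (\forall u \near t, hlift_at gamma c1 u) ->
  (\forall u \near t, hlift_at gamma c2 u) -> c1 t = c2 t ->
  \forall u \near t, c1 u = c2 u.
Proof.
move=> l1 l2 c12; have [g gP] := hlift_near_unique l1 l2.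
have g1 : g = 1%g by apply: (@act_fixed (c1 t)); rewrite -(nbhs_singleton gP).
by apply: filterS gP => u ->; rewrite g1 (pb_act1 bundle).
Qed.

(** Around each time the curves differ by one group element, which is 1 as soon as they meet there,
    the action being free. *)
Lemma hlift_unique gamma c1 c2 a b : (forall t, hlift_at gamma c1 t) ->
  (forall t, hlift_at gamma c2 t) -> a <= b -> c1 a = c2 a -> c1 b = c2 b.
Proof.
move=> l1 l2; apply: (interval_induction
  (Q := fun a b => c1 a = c2 a -> c1 b = c2 b)); last by move=> ? ? ? _ _; auto.
move=> t.
have n1 : \forall u \near t, hlift_at gamma c1 u by apply: filterE.
have n2 : \forall u \near t, hlift_at gamma c2 u by apply: filterE.
have [g gP] := hlift_near_unique n1 n2.
have [e e0 eP] := near_itv gP; exists e => // x y tx xy yt.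
have [-> ->] : c2 x = act (c1 x) g /\ c2 y = act (c1 y) g.
  by split; apply: eP; rewrite ?tx ?yt ?(lt_le_trans tx)// (le_lt_trans xy).
by move=> /esym/act_fixed ->; rewrite (pb_act1 bundle).
Qed.

(** In a fixed chart, A of the velocity is the sum of the derivatives of the coordinates of the
    curve times the components of the form, which are smooth functions taken along the curve. *)
Lemma smooth_at_form (c : R -> P) t : smooth_at c t ->
  exists V : set R, [/\ open V, V t &
    forall j, Dk j V (fun u => A (c u) (velocity c u))].
Proof.
move=> [e [V [ae oV Vt eV DV]]]; exists V; split=> // j.
pose x := e \o c; pose b := rV_fbasis (R := R) n.
pose Phi i z := A (param e z) (chart_vector e z (delta_mx 0 i)).
have Dx i : Dk i V (derive1 x) := (DV i.+1).2.
apply: (@eq_Dk _ _ _ _ (fun u => \sum_i (derive1 x u) 0 i *: (Phi i \o x) u)).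
- exact: oV.
- move=> u Vu; have su : smooth_at c u by exists e, V.
  rewrite (velocity_chart_vector su ae (eV _ Vu)).
  rewrite {2}[derive1 (e \o c) u]rV_decomp /chart_vector !linear_sum/=.
  apply: eq_bigr => i _.
  by rewrite !linearZ /= /Phi /chart_vector /= coordK//; exact: eV.
apply: (Dk_sum _ oV) => i; apply: (Dk_scale oV).
  exact: (Dk_bcoord (b := b) i oV (Dx j)).
apply: (Dk_comp b oV (V := cod e) (f := x)).
- by move=> u Vu; exact/coord_cod/eV.
- exact: (cf_smooth conn).
- exact: DV.
Qed.

End bundle.

(* The equation g^-1 g' = Ad(g^-1) X is g' = (dR_g) X; in the chart at 1 its
   right-hand side is a combination of fixed vector fields with coefficients
   the components of X. *)
Lemma lie_group_ode (R : realType) (k : nat) (G : lieGroupType R k)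
    (X : R -> 'rV[R]_k) (a : R) (V : set R) :
  open V -> V a -> (forall j, Dk j V X) ->
  exists g : R -> G, \forall t \near a, smooth_at g t /\
    velocity (fun u => (g t)^-1 * g u)%g t = Ad ((g t)^-1)%g (X t).
Proof.
move=> oV Va DX.
pose d := chart_at (1%g : G); pose x1 := d 1%g.
pose br := rV_fbasis (R := R) k; pose bp := pair_fbasis br br.
have ad : atlas d := chart_at_atlas _.
have d1 : dom d 1%g := chart_at_dom _.
have px1 : param d x1 = 1%g by exact: coordK.
have cx1 : cod d x1 by exact: coord_cod.
pose mult (z : 'rV[R]_k * 'rV[R]_k) := (param d z.1 * param d z.2)%g.
have mS : smooth_on2 setT (fun x y : G => x * y)%g := mulg_smooth.
have [cm sm] := mS d d ad ad; have {sm} sm := sm d ad.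
set S := (X in Cinfty X _) in sm.
have Sx y : cod d y -> S (x1, y).
  by move=> cy; split=> //; rewrite /= px1 mul1g; exact: param_dom.
pose psi := d \o mult.
pose v (i : 'I_k) : 'rV[R]_k * 'rV[R]_k := (delta_mx 0 i, 0).
(* The derivative of the product in its left factor at 1: in the chart, the right-invariant vector
   field whose value at 1 is the i-th basis vector. *)
pose B i y := 'D_(v i) psi (x1, y).
have nS : nbhs (x1, x1) S.
  apply: filterI.
    have : nbhs (x1, x1) (cod d `*` cod d).
      exists (cod d, cod d) => //=.
      by split; apply: open_nbhs_nbhs; split=> //; exact: open_cod.
    by apply: filterS => -[y z] [].
  apply: (cm (x1, x1)) => //.
  by rewrite /= px1 mul1g; exact: near_dom_chart_at.
have [|i|y [ya dy]] := @affine_ode R k 'I_k (fun i u => X u 0 i) B a x1.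
- move=> i; apply: filterS (open_nbhs_nbhs (conj oV Va)) => t Vt.
  have [dX _] := Dk_bcoord (b := br) i oV (DX 1%N).
  exact/differentiable_continuous/derivable1_diffP/dX.
- have [r [K [r0 K0 rK]]] := C1_locally_lipschitz bp nS ((sm 2%N).2 (v i)).
  have pn (y z : 'rV[R]_k) : `|((x1, y) : 'rV[R]_k * 'rV[R]_k) - (x1, z)| = `|y - z|.
    by rewrite prod_normE/= subrr normr0 max_r.
  exists r, K; split=> // y z yr zr.
  by have := rK (x1, y) (x1, z); rewrite !pn; exact.
have [dya _] := nbhs_singleton dy.
have nc : \forall t \near a, cod d (y t).
  have : {for a, continuous y}.
    exact/differentiable_continuous/derivable1_diffP.
  by apply; rewrite ya; apply: open_nbhs_nbhs; split=> //; exact: open_cod.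
have : \forall t \near a, (cod d (y t) /\ (derivable y t 1 /\
    derive1 y t = \sum_i X t 0 i *: B i (y t))) /\ V t.
  exact: filterI (filterI nc dy) (open_nbhs_nbhs (conj oV Va)).
move=> /nbhs_open[W [oW Wa WP]].
have DXW j := sub_Dk (fun u Wu => (WP u Wu).2) (DX j).
(* Bootstrapping: order j of y yields order j of the right-hand side, hence order j + 1 of y, on the
   same [W] throughout. *)
have Dy j : Dk j W y.
  elim: j => [//|j IH]; split; first by move=> t Wt; exact: (WP t Wt).1.2.1.
  apply: (@eq_Dk _ _ _ _ (fun t => \sum_i X t 0 i *: B i (y t))).
  - exact: oW.
  - by move=> t Wt; rewrite (WP t Wt).1.2.2.
  apply: (Dk_sum _ oW) => i; apply: (Dk_scale oW).
    exact: (Dk_bcoord (b := br) i oW (DXW j)).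
  apply: (Dk_comp bp oW (V := S) (f := fun t => (x1, y t)) (g := 'D_(v i) psi)).
  - by move=> t /WP[[cy _] _]; exact: Sx.
  - exact: (sm j.+1).2.
  - by apply: (Dk_pair oW) => //; exact: Dk_cst.
pose g := param d \o y; exists g.
apply: filterS (open_nbhs_nbhs (conj oW Wa)) => t Wt.
have cW u : W u -> cod d (y u) by move=> /WP[[]].
have sg : smooth_at g t by exact: smooth_at_param ad oW Wt cW Dy.
split=> //.
pose l := line (1%g : G) (X t).
have sl : smooth_at l 0 := smooth_at_line _ _.
have l0 : l 0 = 1%g := line0 _ _.
(* A curve through [g t] with velocity dR_g X: in the chart its left factor is x1 + u X. Comparing
   [g] with it frees the equation from the chart. *)
pose e u := (l u * g t)%g.
have se : smooth_at e 0 by apply: smooth_at_mulg => //; exact: smooth_at_cst.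
have e0 : e 0 = g t by rewrite /e l0 mul1g.
have dg : dom d (g t) by exact/param_dom/cW.
have de : dom d (e 0) by rewrite e0.
have dge : derive1 (d \o g) t = derive1 (d \o e) 0.
  transitivity (derive1 y t).
    apply: near_derive1; apply: filterS (open_nbhs_nbhs (conj oW Wt)) => u Wu.
    by rewrite /g/= paramK//; exact: cW.
  have [_ [_ ->]] := (WP t Wt).1.
  have dpsi : differentiable psi (x1, y t) by apply: (sm 1%N).1; exact/Sx/cW.
  pose h (u : R) := (x1 + u *: X t, y t).
  have dl : derivable (fun u : R => x1 + u *: X t) 0 1.
    exact: derivable_line.
  have dc : derivable (cst (y t) : R -> _) 0 1 by exact: derivable_cst.
  have [dh h'] := derivable_pair dl dc.
  have h0 : (x1 + 0 *: X t, y t) = (x1, y t) by rewrite scale0r addr0.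
  have dpsi' : differentiable psi (h 0) by rewrite /h h0.
  have [_ H] := is_derive_compd dpsi' dh.
  apply/esym; apply: etrans (etrans H _).
    by apply: near_derive1; apply: filterE.
  rewrite h' derive1_line derive1_cst /h h0 (diff_basis bp)//.
  (* The direction is (X, 0), so the basis vectors of the second factor contribute nothing. *)
  rewrite big_sumType/= [X in _ + X]big1 ?addr0// => i _.
  by rewrite mxE scale0r.
have vge : velocity g t = velocity e 0.
  rewrite (velocity_chart_vector sg ad dg) (velocity_chart_vector se ad de).
  by rewrite e0 dge.
rewrite (velocity_mulgr _ sg) vge -e0 -(velocity_mulgr _ se).
have -> : X t = velocity l 0 by rewrite velocity_line.
rewrite -(Ad_velocity _ sl l0); apply: velocity_eq; apply: filterE => u.
by rewrite e0 invgK /e mulgA.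
Qed.

(** * Existence of lifts over an interval *)

Section global_lift.
Context {R : realType} {m n k : nat}.
Context {M : manifoldType R m} {P : manifoldType R n} {G : lieGroupType R k}.
Context (pi : P -> M) (act : P -> G -> P).
Hypothesis bundle : principal_bundle pi act.
Context (A : P -> {linear 'rV[R]_n -> 'rV[R]_k}).
Hypothesis conn : connection_form act A.

Lemma hlift_local (gamma : R -> M) t : smooth_at gamma t ->
  exists c, \forall u \near t, hlift_at pi A gamma c u.
Proof.
move=> sg.
have [U [tau [sigma [oU Ut [_ ss _ ps _]]]]] := pb_trivial bundle (gamma t).
pose s u := sigma (gamma u) 1%g.
have nU : \forall u \near t, U (gamma u).
  by apply: (smooth_at_continuous sg); exact: open_nbhs_nbhs.
have sst : smooth_at s t.
  apply: (smooth_at_comp2 ss sg (smooth_at_cst 1%g t)).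
  by apply: filterS nU => u Uu; split.
have [V [oV Vt DV]] := smooth_at_form conn sst.
(* With this sign the two terms of [connection_act] cancel. *)
pose X u := - A (s u) (velocity s u).
have DX j : Dk j V X.
  apply: (@eq_Dk _ _ _ _ (fun u => (-1 : R) *: A (s u) (velocity s u))).
  - exact: oV.
  - by move=> u _; rewrite scaleN1r.
  by apply: (Dk_scale oV) (DV j); exact: Dk_cst.
have [g gP] := lie_group_ode G oV Vt DX.
exists (fun u => act (s u) (g u)).
apply: filterS3 (smooth_at_near sst) nU gP => u su Uu [sgu vgu].
split.
- exact: (smooth_at_act bundle).
- by rewrite (connection_act bundle conn su sgu) vgu /X AdN subrr.
- by rewrite (pb_pi_act bundle) (ps _ _ Uu).1.
Qed.

(** The property carried along the interval ranges over all initial points, as the second piece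
    starts wherever the first one ends. Lifts are required around the endpoints too, so that
    consecutive pieces overlap and can be compared. *)
Lemma hlift_exists (gamma : R -> M) a b : (forall t, smooth_at gamma t) ->
  a <= b -> forall p, pi p = gamma a -> exists c, c a = p /\
    forall t, a <= t <= b -> \forall u \near t, hlift_at pi A gamma c u.
Proof.
move=> sg; apply: (interval_induction (Q := fun a b => forall p,
  pi p = gamma a -> exists c, c a = p /\
    forall t, a <= t <= b -> \forall u \near t, hlift_at pi A gamma c u)).
  move=> t; have [c cP] := hlift_local (sg t).
  have [e e0 eP] := near_itv (near_near cP); exists e => // x y tx xy yt p px.
  have ncx : \forall u \near x, hlift_at pi A gamma c u.
    by apply: eP; rewrite tx (le_lt_trans xy).
  have [_ _ pcx] := nbhs_singleton ncx.
  have [g pg] := fiber_transitive bundle (etrans pcx (esym px)).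
  exists (fun u => act (c u) g); split=> // z /andP[xz zy].
  have : \forall u \near z, hlift_at pi A gamma c u.
    by apply: eP; rewrite (lt_le_trans tx)//= (le_lt_trans zy).
  by apply: filterS => u; exact: (hlift_at_act bundle conn).
move=> {}a {}b c ab bc Q1 Q2 p pa.
have [c1 [c1a l1]] := Q1 p pa.
have l1b : \forall u \near b, hlift_at pi A gamma c1 u by apply: l1; rewrite ab lexx.
have [_ _ pb] := nbhs_singleton l1b.
have [c2 [c2b l2]] := Q2 _ pb.
have l2b : \forall u \near b, hlift_at pi A gamma c2 u by apply: l2; rewrite bc lexx.
have c12 := hlift_near_eq bundle conn l1b l2b (esym c2b).
(* Smoothness at the junction holds because the two pieces agree on both sides of b, by [c12]. *)
pose c3 u := if u < b then c1 u else c2 u.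
have c31 t : t < b -> \forall u \near t, c1 u = c3 u.
  move=> tb; have : \forall u \near t, u < b by exact: lt_nbhsl.
  by apply: filterS => u ub; rewrite /c3 ub.
have c32 t : b < t -> \forall u \near t, c2 u = c3 u.
  move=> tb; have : \forall u \near t, b < u by exact: lt_nbhsr.
  by apply: filterS => u ub; rewrite /c3 ltNge ltW.
have c3b : \forall u \near b, c1 u = c3 u.
  by apply: filterS c12 => u c12u; rewrite /c3; case: ifP.
have glue (c0 : R -> P) (t : R) : (\forall u \near t, c0 u = c3 u) ->
    (\forall u \near t, hlift_at pi A gamma c0 u) ->
    \forall u \near t, hlift_at pi A gamma c3 u.
  move=> /near_near c03; apply: filterS2 c03 => u; exact: hlift_at_eq.
exists c3; split.
  rewrite /c3; case: ltP => // ba; rewrite -c1a.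
  by have -> : a = b by apply/eqP; rewrite eq_le ab.
move=> t /andP[at_ tc]; have [tb|bt|->] := ltgtP t b.
- by apply: glue (c31 t tb) _; apply: l1; rewrite at_ ltW.
- by apply: glue (c32 t bt) _; apply: l2; rewrite tc ltW.
- exact: glue c3b l1b.
Qed.

End global_lift.

(** * Classes of paths *)

Section paths_on_the_line.
Context {R : realType}.

(* Replaces the junk values outside [t0, t1], so that paths constant near their
   endpoints become smooth on the whole line. *)
Definition stopped (T : Type) (c : pcurve R T) (t : R) : T :=
  c (Num.max (t0 c) (Num.min (t1 c) t)).

Lemma stopped_id (T : Type) (c : pcurve R T) t : t0 c <= t <= t1 c ->
  stopped c t = c t.
Proof. by move=> /andP[t0t tt1]; rewrite /stopped min_r// max_r. Qed.

Lemma stopped_le (T : Type) (c : pcurve R T) t : t <= t0 c ->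
  stopped c t = c (t0 c).
Proof.
move=> tt0; rewrite /stopped min_r ?max_l//.
by rewrite (le_trans tt0)// ltW// t0_lt_t1.
Qed.

Lemma stopped_ge (T : Type) (c : pcurve R T) t : t1 c <= t ->
  stopped c t = c (t1 c).
Proof. by move=> tt1; rewrite /stopped min_l// max_r// ltW// t0_lt_t1. Qed.

Lemma stopped_near_t0 (T : Type) (c : pcurve R T) :
  (\forall t \near (t0 c)^'+, c t = c (t0 c)) ->
  \forall u \near t0 c, stopped c u = c (t0 c).
Proof.
rewrite near_withinE => cc.
have nt1 : \forall u \near t0 c, u < t1 c by apply: lt_nbhsl; exact: t0_lt_t1.
apply: filterS2 cc nt1 => u cu ut1; have [ut0|t0u] := leP u (t0 c).
  exact: stopped_le.
by rewrite stopped_id ?cu// !ltW.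
Qed.

Lemma stopped_near_t1 (T : Type) (c : pcurve R T) :
  (\forall t \near (t1 c)^'-, c t = c (t1 c)) ->
  \forall u \near t1 c, stopped c u = c (t1 c).
Proof.
rewrite near_withinE => cc.
have nt0 : \forall u \near t1 c, t0 c < u by apply: lt_nbhsr; exact: t0_lt_t1.
apply: filterS2 cc nt0 => u cu ut0; have [t1u|ut1] := leP (t1 c) u.
  exact: stopped_ge.
by rewrite stopped_id ?cu// !ltW.
Qed.

(** Reduces every local property of the extended curve to a constant curve or to [c] itself; the
    endpoints fall under the first case. *)
Lemma stopped_local (T : Type) (c : pcurve R T) t :
  (\forall t \near (t0 c)^'+, c t = c (t0 c)) ->
  (\forall t \near (t1 c)^'-, c t = c (t1 c)) ->
  (exists p, \forall u \near t, stopped c u = p) \/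
  t0 c <= t <= t1 c /\ \forall u \near t, stopped c u = c u.
Proof.
move=> c0 c1; have [tt0|t0t|->] := ltgtP t (t0 c); last first.
- by left; exists (c (t0 c)); exact: stopped_near_t0.
- have [tt1|t1t|->] := ltgtP t (t1 c); last first.
  + by left; exists (c (t1 c)); exact: stopped_near_t1.
  + left; exists (c (t1 c)); have := lt_nbhsr t1t.
    by apply: filterS => u /ltW; exact: stopped_ge.
  right; split=> //.
  apply: filterS2 (lt_nbhsr t0t) (lt_nbhsl tt1) => u t0u ut1.
  by rewrite stopped_id// !ltW.
- left; exists (c (t0 c)); have := lt_nbhsl tt0.
  by apply: filterS => u /ltW; exact: stopped_le.
Qed.

(** Smoothness at t is an open condition on t, so the set of all such t is an admissible [W]. *)
Lemma smooth_pathP (n : nat) (N : manifoldType R n) (c : pcurve R N) :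
  smooth_path c <-> [/\ forall t, t0 c <= t <= t1 c -> smooth_at c t,
    \forall t \near (t0 c)^'+, c t = c (t0 c) &
    \forall t \near (t1 c)^'-, c t = c (t1 c)].
Proof.
split=> [[[W [oW cW sW]] c0 c1]|[sc c0 c1]]; split=> //.
  move=> t tc; apply: (smooth_atP c oW).1 => //; apply: cW.
  by rewrite /= in_itv.
have oW : open [set t | smooth_at c t].
  by rewrite openE => t /smooth_at_near.
exists [set t | smooth_at c t]; split=> //.
exact/(smooth_atP c oW).
Qed.

Lemma smooth_at_stopped (n : nat) (N : manifoldType R n) (c : pcurve R N) t :
  smooth_path c -> smooth_at (stopped c) t.
Proof.
move=> /smooth_pathP[sc c0 c1].
have [[p cp]|[tc cc]] := stopped_local t c0 c1.
  apply: smooth_at_eq (smooth_at_cst p t).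
  by apply: filterS cp => u ->.
by apply: smooth_at_eq (sc t tc); apply: filterS cc => u ->.
Qed.

Lemma horizontal_stopped (n k : nat) (P : manifoldType R n)
    (A : P -> {linear 'rV[R]_n -> 'rV[R]_k}) (c : pcurve R P) t :
  smooth_path c -> horizontal A c -> A (stopped c t) (velocity (stopped c) t) = 0.
Proof.
move=> [_ c0 c1] hc.
have [[p cp]|[tc cc]] := stopped_local t c0 c1.
  by rewrite (velocity_eq cp) velocity_cst linear0.
by rewrite (velocity_eq cc) (nbhs_singleton cc); exact: hc.
Qed.

(** * Translations of time *)

Lemma shift_diff_quotient (F : normedModType R) (f : R -> F) (a t : R) :
  (fun h : R => h^-1 *: (((fun u => f (u + a)) \o shift t) (h *: 1) - f (t + a))) =
  (fun h : R => h^-1 *: ((f \o shift (t + a)) (h *: 1) - f (t + a))).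
Proof. by apply/funext => h /=; rewrite addrA. Qed.

Lemma derive1_shift (F : normedModType R) (f : R -> F) (a t : R) :
  derive1 (fun u => f (u + a)) t = derive1 f (t + a).
Proof. by rewrite !derive1E /derive shift_diff_quotient. Qed.

Lemma Dk_shift (F : normedModType R) j (V : set R) (f : R -> F) (a : R) :
  Dk j V f -> Dk j [set t | V (t + a)] (fun t => f (t + a)).
Proof.
elim: j f => // j IH f [df Df]; split.
  by move=> t /df; rewrite /derivable shift_diff_quotient.
rewrite (_ : derive1 _ = fun t => derive1 f (t + a)); first exact: IH.
by apply/funext => t; exact: derive1_shift.
Qed.

Lemma smooth_at_shift (n : nat) (N : manifoldType R n) (c : R -> N) (a t : R) :
  smooth_at c (t + a) -> smooth_at (fun u => c (u + a)) t.
Proof.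
move=> [e [V [ae oV Vt eV DV]]]; exists e, [set u | V (u + a)]; split=> //.
- by apply: open_comp oV => u _; apply: cvgD; [exact: cvg_id|exact: cvg_cst].
- by move=> u; exact: eV.
- by move=> j; exact: (Dk_shift (f := e \o c)).
Qed.

Lemma velocity_shift (n : nat) (N : manifoldType R n) (c : R -> N) (a t : R) :
  velocity (fun u => c (u + a)) t = velocity c (t + a).
Proof. exact: (derive1_shift (chart_at (c (t + a)) \o c)). Qed.

End paths_on_the_line.

(** * Lifts of classes of paths *)

Section horizontal_lifts.
Context {R : realType} {m n k : nat}.
Context {M : manifoldType R m} {P : manifoldType R n} {G : lieGroupType R k}.
Context (pi : P -> M) (act : P -> G -> P).
Hypothesis bundle : principal_bundle pi act.
Context (A : P -> {linear 'rV[R]_n -> 'rV[R]_k}).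
Hypothesis conn : connection_form act A.

(** The curve that is lifted is the stopped path, smooth on the whole line and equal to [c] on
    [t0, t1]; the lift is then restricted to that interval. *)
Lemma horizontal_lift_exists (c : pcurve R M) p : smooth_path c ->
  c (t0 c) = pi p -> exists q, is_horizontal_lift pi A (curve_class c) p q.
Proof.
move=> sc cp; have [_ c0 c1] := sc; have t01 := ltW (t0_lt_t1 c).
have i0 : t0 c <= t0 c <= t1 c by rewrite lexx.
have i1 : t0 c <= t1 c <= t1 c by rewrite lexx andbT.
have pp : pi p = stopped c (t0 c) by rewrite stopped_id.
have [d [dp dl]] := hlift_exists bundle conn
  (fun t => smooth_at_stopped t sc) t01 pp.
have cst_lift (t : R) : t0 c <= t <= t1 c ->
    (\forall u \near t, stopped c u = c t) -> \forall u \near t, d u = d t.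
  move=> tc cct; apply: (hlift_near_eq bundle conn (dl t tc)) => //.
  have [_ _ pd] := nbhs_singleton (dl t tc).
  apply: filterS cct => u cu; split; first exact: smooth_at_cst.
    by rewrite velocity_cst linear0.
  by rewrite pd cu stopped_id.
have d0 := cst_lift _ i0 (stopped_near_t0 c0).
have d1 := cst_lift _ i1 (stopped_near_t1 c1).
exists (curve_class (PCurve (t0_lt_t1 c) d)); split.
- exists (PCurve (t0_lt_t1 c) d) => //; split.
    apply/smooth_pathP; split=> /=.
    + by move=> t /dl/nbhs_singleton[].
    + by rewrite near_withinE; apply: filterS d0.
    + by rewrite near_withinE; apply: filterS d1.
  by move=> t /dl/nbhs_singleton[].
- by rewrite curve_startE.
- rewrite /piA curve_mapE; apply/curve_classP/asboolP; exists 0.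
  rewrite !subr0; split=> //= t tc.
  have [_ _ pd] := nbhs_singleton (dl t tc).
  by rewrite addr0 pd stopped_id.
Qed.

(** The two projections agree up to a translation by some a. The same a works for the lifts:
    translated by a, the first stopped lift lies over the same curve as the second, from the same
    initial point. *)
Lemma horizontal_lift_unique gamma p q1 q2 :
  is_horizontal_lift pi A gamma p q1 -> is_horizontal_lift pi A gamma p q2 ->
  q1 = q2.
Proof.
move=> [[c1 [s1 h1] <-] st1 <-] [[c2 [s2 h2] <-] st2].
rewrite /piA !curve_mapE => /esym/curve_classP/asboolP[a [/= e0 e1 e]].
apply/curve_classP/asboolP; exists a; split=> // t tc.
rewrite curve_startE in st1; rewrite curve_startE in st2.
have t0a : t0 c2 + a = t0 c1 by rewrite e0 subrK.
have t1a : t1 c2 + a = t1 c1 by rewrite e1 subrK.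
have stop_shift u : pi (stopped c2 u) = pi (stopped c1 (u + a)).
  have t01 := ltW (t0_lt_t1 c2).
  have [ut0|t0u] := leP u (t0 c2).
    rewrite (stopped_le ut0) stopped_le; last by rewrite -t0a lerD2r.
    by rewrite e ?lexx// t0a.
  have [t1u|ut1] := leP (t1 c2) u.
    rewrite (stopped_ge t1u) stopped_ge; last by rewrite -t1a lerD2r.
    by rewrite e ?lexx ?andbT// t1a.
  have uc : t0 c2 <= u <= t1 c2 by rewrite !ltW.
  by rewrite !stopped_id ?e// -t0a -t1a !lerD2r.
have l1 u : hlift_at pi A (pi \o stopped c2) (fun v => stopped c1 (v + a)) u.
  split.
  - exact/smooth_at_shift/smooth_at_stopped.
  - by rewrite velocity_shift; exact: horizontal_stopped.
  - by rewrite /= stop_shift.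
have l2 u : hlift_at pi A (pi \o stopped c2) (stopped c2) u.
  by split=> //; [exact: smooth_at_stopped|exact: horizontal_stopped].
have /andP[t0t tt1] := tc.
have := hlift_unique bundle conn l1 l2 t0t.
rewrite [stopped c2 (t0 c2)]stopped_le// st2 t0a stopped_le// st1 => /(_ erefl).
rewrite (stopped_id tc) stopped_id; first by move=> ->.
by rewrite -t0a -t1a !lerD2r.
Qed.

Lemma ev0_lift_exists gamma p : ev0_pullback pi (gamma, p) ->
  exists q, is_horizontal_lift pi A gamma p q.
Proof.
move=> [/= [c sc <-]]; rewrite curve_startE; exact: horizontal_lift_exists.
Qed.

Lemma mu_lift x : ev0_pullback pi x ->
  is_horizontal_lift pi A x.1 x.2 (mu pi A x).
Proof. by case: x => gamma p /ev0_lift_exists; exact: xgetPex. Qed.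

Lemma hpath_pullback q : hpaths A q -> ev0_pullback pi (piA pi q, curve_start q).
Proof.
move=> [c [sc hc] <-]; rewrite /piA curve_mapE; split; last by rewrite !curve_startE.
exists (pcurve_map pi c) => //; move/smooth_pathP: sc => [sc c0 c1].
apply/smooth_pathP; split=> /= [t tc||].
- exact/(smooth_at_pi bundle)/sc.
- by apply: filterS c0 => t ->.
- by apply: filterS c1 => t ->.
Qed.

Lemma hpath_act_lift gamma p q g : is_horizontal_lift pi A gamma p q ->
  is_horizontal_lift pi A gamma (act p g) (hpath_act act q g).
Proof.
move=> [[c [sc hc] <-] <- <-]; rewrite /hpath_act /piA !curve_mapE !curve_startE.
move/smooth_pathP: sc => [sc c0 c1].
have lc t (tc : t0 c <= t <= t1 c) : hlift_at pi A (pi \o c) (act^~ g \o c) t.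
  by apply: (hlift_at_act bundle conn); split=> //; [exact: sc|exact: hc].
split=> //.
- exists (pcurve_map (act^~ g) c) => //; split; last by move=> t /lc[].
  apply/smooth_pathP; split=> /= [t /lc[]//||].
  + by apply: filterS c0 => t ->.
  + by apply: filterS c1 => t ->.
- by rewrite curve_startE.
- rewrite /piA curve_mapE; congr curve_class; congr PCurve.
  by apply/funext => t /=; rewrite (pb_pi_act bundle).
Qed.

End horizontal_lifts.

Theorem proposition2p1 (R : realType) (m n k : nat)
    (M : manifoldType R m) (P : manifoldType R n) (G : lieGroupType R k)
    (pi : P -> M) (act : P -> G -> P)
    (A : P -> {linear 'rV[R]_n -> 'rV[R]_k}) :
  principal_bundle pi act ->
  connection_form act A ->
  [/\ (forall gamma p, ev0_pullback pi (gamma, p) ->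
         exists! q, is_horizontal_lift pi A gamma p q),
      set_bij (ev0_pullback pi) (hpaths A) (mu pi A),
      (forall x g, ev0_pullback pi x ->
         mu pi A (ev0_act act x g) = hpath_act act (mu pi A x) g) &
      {in ev0_pullback pi, piA pi \o mu pi A =1 pi0} ].
Proof.
move=> bundle conn.
have lift_mu := mu_lift bundle conn.
have uniq := horizontal_lift_unique bundle conn.
split.
- move=> gamma p /(ev0_lift_exists bundle conn)[q ql].
  by exists q; split=> // q' /(uniq _ _ _ _ ql).
- split.
  + by move=> x /lift_mu[].
  (* The pair is recovered from its lift, as projection and initial point. *)
  + move=> [g p] [g' p'] /set_mem/lift_mu[_ /= st pg] /set_mem/lift_mu[_ /= st' pg'].
    by move=> e; congr pair; [rewrite -pg e pg'|rewrite -st e st'].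
  + move=> q hq; have xq := hpath_pullback bundle hq.
    exists (piA pi q, curve_start q) => //.
    by apply: (uniq _ _ _ _ (lift_mu _ xq)).
- move=> x g xev; apply: uniq (hpath_act_lift bundle conn g (lift_mu _ xev)).
  apply: (lift_mu (ev0_act act x g)); split; first exact: xev.1.
  by rewrite /= (pb_pi_act bundle); exact: xev.2.
- by move=> x /set_mem/lift_mu[].
Qed.
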